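(* Let $X_1,\dots,X_n$ and $Y_1,\dots,Y_m$ be mutually independent, where the $X_i$ are realizations of a centered random vector $X\in\mathbb{R}^d$ with covariance matrix $\Sigma_1$ and the $Y_i$ are realizations of a centered random vector $Y\in\mathbb{R}^d$ with covariance matrix $\Sigma_2$, and $n\asymp m$. Suppose there exist random vectors $U_1,U_2\in\mathbb{R}^d$ with $\mathbb{E}(U_i)=0$ and $\mathbb{E}(U_iU_i^{\top})=I_d$, $i=1,2$, such that $X=\Sigma_1^{1/2}U_1$, $Y=\Sigma_2^{1/2}U_2$ and $$L_1:=\max\Big(\sup_{v\in\mathbb{S}^{d-1}}\|v^{\top}U_1\|_{\psi_2},\ \sup_{v\in\mathbb{S}^{d-1}}\|v^{\top}U_2\|_{\psi_2}\Big)<\infty.$$ Further assume that $(n,m,d,s)$ satisfies $s\log(ed/s)\log n=o(n)$. Then, for all sufficiently large $\lambda>0$, $$\inf_{(\Sigma_1,\Sigma_2)\in\mathbb{M}(\lambda)}\mathbb{P}_{(\Sigma_1,\Sigma_2)}(T_\alpha=1)\to1\quad\text{as }n\to\infty,$$ where $\mathbb{P}_{(\Sigma_1,\Sigma_2)}$ represents the joint distribution of $X_1,\dots,X_n,Y_1,\dots,Y_m$ with covariance matrices $\Sigma_1$ and $\Sigma_2$.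
   Context: Asymptotics are as $n,m\to\infty$; $d$ and the integer $1\le s\le d$ may depend on $n$; $\alpha\in(0,1)$ is the fixed level and $L_1$ is regarded as a fixed finite constant. $n\asymp m$ means that $n/m$ and $m/n$ are bounded. Notation: $\mathbb{S}^{d-1}$ is the Euclidean unit sphere; $\mathbb{V}(s,d)=\{v\in\mathbb{R}^d:\|v\|_2=1,\ \|v\|_0\le s\}$, with $\|v\|_0$ the number of non-zero entries; $\lambda_{\max,s}(M)=\sup_{v\in\mathbb{V}(s,d)}v^{\top}Mv$, $\lambda_{\min,s}(M)=\inf_{v\in\mathbb{V}(s,d)}v^{\top}Mv$. For a random variable $Z$, $\|Z\|_{\psi_2}=\inf\{c>0:\mathbb{E}\exp(Z^2/c^2)-1\le 1\}$. The alternative class, of pairs of ($d\times d$ covariance) matrices, is $$\mathbb{M}(\lambda)=\Big\{(M_1,M_2):\ \frac{\lambda_{\max,s}(M_\ell)}{\lambda_{\min,s}(M_\ell)}\le C,\ \ell=1,2,\ \ \sqrt{\tfrac{n+m}{nm}}\sup_{v\in\mathbb{V}(s,d)}\Big|\frac{v^{\top}(M_1-M_2)v}{v^{\top}(M_1/n+M_2/m)v}\Big|\ge\lambda\sqrt{s\log(ed/s)}\Big\}$$ for some constant $C>0$ independent of $(n,m,d)$. Let $\hat\Sigma_1=n^{-1}\sum_{i=1}^nX_iX_i^{\top}$, $\hat\Sigma_2=m^{-1}\sum_{i=1}^mY_iY_i^{\top}$, and $$\hat{\mathcal{Q}}_{\max}=\sup_{v\in\mathbb{V}(s,d)}\Big|\sqrt{\frac{n+m}{nm}}\,\frac{v^{\top}(\hat\Sigma_1-\hat\Sigma_2)v}{v^{\top}(\hat\Sigma_1/n+\hat\Sigma_2/m)v}\Big|,$$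 $$\hat{\mathcal{B}}_{\max}=\sup_{v\in\mathbb{V}(s,d)}\Big|\sqrt{\frac{n+m}{nm}}\,\frac{v^{\top}\{n^{-1}\sum_{i=1}^n\xi_i(X_iX_i^{\top}-\hat\Sigma_1)-m^{-1}\sum_{i=1}^m\eta_i(Y_iY_i^{\top}-\hat\Sigma_2)\}v}{v^{\top}(\hat\Sigma_1/n+\hat\Sigma_2/m)v}\Big|,$$ where $\xi_1,\dots,\xi_n,\eta_1,\dots,\eta_m$ are independent standard Gaussian random variables independent of the data. Let $q_\alpha$ be the $(1-\alpha)$-th quantile of the conditional distribution of $\hat{\mathcal{B}}_{\max}$ given the data, and $T_\alpha=\mathbf{1}(\hat{\mathcal{Q}}_{\max}\ge q_\alpha)$.
   Formalization: The dimension d is additionally assumed to tend to infinity with n; for bounded d (e.g. d = s = 1, n = m, Gaussian data) the power at any fixed λ tends to a limit below 1, so the claim as stated fails. *)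

(* Defs.v *)
From HB Require Import structures.
From mathcomp Require Import all_boot all_order all_algebra.
From mathcomp Require Import all_classical all_reals all_analysis.
Set Implicit Arguments.
Unset Strict Implicit.
Unset Printing Implicit Defensive.
Import Order.TTheory GRing.Theory Num.Theory.
Import numFieldNormedType.Exports.

Local Open Scope classical_set_scope.
Local Open Scope ring_scope.

(* Random vectors take values in [d.-tuple R], which carries the product
   (= Borel) sigma-algebra; [vec] moves to column vectors for linear algebra. *)
Definition vec (R : realType) (d : nat) (x : d.-tuple R) : 'cV[R]_d :=
  \col_j tnth x j.

(* The norm that the library puts on ['cV[R]_d] is the sup norm, hence an
   explicit Euclidean norm. *)
Definition norm2 (R : realType) (d : nat) (v : 'cV[R]_d) : R :=
  Num.sqrt (\sum_j v j 0 ^+ 2).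

Definition norm0 (R : realType) (d : nat) (v : 'cV[R]_d) : nat :=
  #|[set j | v j 0 != 0]%SET|.

Definition sphere (R : realType) (d : nat) : set 'cV[R]_d :=
  [set v | norm2 v = 1].

Definition sparse_sphere (R : realType) (s d : nat) : set 'cV[R]_d :=
  [set v | norm2 v = 1 /\ (norm0 v <= s)%N].

Definition qform (R : realType) (d : nat) (M : 'M[R]_d) (v : 'cV[R]_d) : R :=
  (v^T *m M *m v) 0 0.

Definition lambda_max (R : realType) (s d : nat) (M : 'M[R]_d) : R :=
  sup [set qform M v | v in @sparse_sphere R s d].

Definition lambda_min (R : realType) (s d : nat) (M : 'M[R]_d) : R :=
  inf [set qform M v | v in @sparse_sphere R s d].

Definition psdmx (R : realType) (d : nat) (M : 'M[R]_d) : Prop :=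
  M^T = M /\ forall v : 'cV[R]_d, 0 <= qform M v.

(* [is_sqrtmx S M] : S is the (unique) positive semidefinite square root
   M^{1/2} of M. *)
Definition is_sqrtmx (R : realType) (d : nat) (S M : 'M[R]_d) : Prop :=
  psdmx S /\ S *m S = M.

(* s log (e d / s) *)
Definition slog (R : realType) (s d : nat) : R :=
  s%:R * ln (expR 1 * d%:R / s%:R).

(* sqrt ((n + m) / (n m)) v^T N v / v^T (M1 / n + M2 / m) v, where x / 0 = 0.
   With M1, M2 the two sample covariance matrices and N the numerator of
   either statistic, a vanishing denominator forces a vanishing numerator. *)
Definition scaled_ratio (R : realType) (n m d : nat) (N M1 M2 : 'M[R]_d)
    (v : 'cV[R]_d) : R :=
  Num.sqrt ((n + m)%:R / (n * m)%:R) *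
  (qform N v / qform (n%:R^-1 *: M1 + m%:R^-1 *: M2) v).

(* The condition [0 < lambda_min] is what gives a meaning to the quotient
   lambda_max / lambda_min. *)
Definition alternatives (R : realType) (n m d s : nat) (C lambda : R) :
    set ('M[R]_d * 'M[R]_d) :=
  [set M | [/\ psdmx M.1 /\ psdmx M.2,
    0 < lambda_min s M.1 /\ lambda_max s M.1 / lambda_min s M.1 <= C,
    0 < lambda_min s M.2 /\ lambda_max s M.2 / lambda_min s M.2 <= C &
    lambda * Num.sqrt (slog R s d) <=
      Num.sqrt ((n + m)%:R / (n * m)%:R) *
      sup [set `|qform (M.1 - M.2) v
                 / qform (n%:R^-1 *: M.1 + m%:R^-1 *: M.2) v|
            | v in @sparse_sphere R s d]]].

Definition sample_cov (R : realType) (n d : nat) (x : n.-tuple (d.-tuple R)) :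
    'M[R]_d :=
  n%:R^-1 *: \sum_(i < n) (vec (tnth x i) *m (vec (tnth x i))^T).

Definition Q_max (R : realType) (n m d s : nat)
    (x : n.-tuple (d.-tuple R)) (y : m.-tuple (d.-tuple R)) : R :=
  sup [set `|scaled_ratio n m (sample_cov x - sample_cov y)
               (sample_cov x) (sample_cov y) v| | v in @sparse_sphere R s d].

Definition boot_cov (R : realType) (n d : nat) (x : n.-tuple (d.-tuple R))
    (xi : n.-tuple R) : 'M[R]_d :=
  n%:R^-1 *: \sum_(i < n)
    (tnth xi i *: (vec (tnth x i) *m (vec (tnth x i))^T - sample_cov x)).

Definition B_max (R : realType) (n m d s : nat)
    (x : n.-tuple (d.-tuple R)) (y : m.-tuple (d.-tuple R))
    (xi : n.-tuple R) (eta : m.-tuple R) : R :=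
  sup [set `|scaled_ratio n m (boot_cov x xi - boot_cov y eta)
               (sample_cov x) (sample_cov y) v| | v in @sparse_sphere R s d].

(* Level-p quantile of a distribution on R. *)
Definition quantile (R : realType) (mu : set R -> \bar R) (p : R) : R :=
  inf [set t : R | (p%:E <= mu [set u | (u <= t)%R])%E].

(* The indicator 1(Q_max >= q). *)
Definition test (R : realType) (n m d s : nat)
    (x : n.-tuple (d.-tuple R)) (y : m.-tuple (d.-tuple R)) (q : R) : R :=
  (q <= Q_max s x y)%R%:R.

(* Infimum of a set of probabilities, taken in [0, 1]: it is 1 on the empty
   set. ([alternatives] is empty when C < 1.) *)
Definition inf_prob (R : realType) (S : set (\bar R)) : \bar R :=
  ereal_inf (S `|` [set 1%E]).

Section Probability.
Context (R : realType) (dT : measure_display) (T : measurableType dT)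
  (P : probability T R).

Local Open Scope ereal_scope.

Definition mutually_independent (I : finType) dE (E : measurableType dE)
    (Z : I -> T -> E) : Prop :=
  forall A : I -> set E, (forall i, measurable (A i)) ->
    P (\bigcap_(i in [set: I]) (Z i @^-1` A i)) =
    \prod_(i : I) P (Z i @^-1` A i).

Definition independent2 dE (E : measurableType dE) dF (F : measurableType dF)
    (Z : T -> E) (W : T -> F) : Prop :=
  forall A B, measurable A -> measurable B ->
    P (Z @^-1` A `&` W @^-1` B) = P (Z @^-1` A) * P (W @^-1` B).

Definition pooled (n m : nat) (E : Type) (x : T -> n.-tuple E)
    (y : T -> m.-tuple E) (k : 'I_n + 'I_m) (w : T) : E :=
  match k with inl i => tnth (x w) i | inr j => tnth (y w) j end.

(* [kappa] is a regular conditional distribution of [B] given [D]. *)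
Definition is_cond_distribution dE (E : measurableType dE)
    (D : T -> E) (B : T -> R) (kappa : R.-pker E ~> R) : Prop :=
  forall (A : set E) (V : set R), measurable A -> measurable V ->
    P (D @^-1` A `&` B @^-1` V) = \int[P]_(w in D @^-1` A) kappa (D w) V.

(* +oo when there is no admissible c. *)
Definition psi2_norm (Z : T -> R) : \bar R :=
  ereal_inf [set c%:E | c in [set c : R | (0 < c)%R /\
    'E_P[fun w => expR (Z w ^+ 2 / c ^+ 2)] - 1 <= 1]].

Definition psi2_sphere (d : nat) (U : T -> d.-tuple R) : \bar R :=
  ereal_sup [set psi2_norm (fun w => (v^T *m vec (U w)) 0 0)%R
            | v in @sphere R d].

Definition centered (d : nat) (Z : T -> d.-tuple R) : Prop :=
  forall j, 'E_P[fun w => tnth (Z w) j] = 0.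

Definition has_covmx (d : nat) (Z : T -> d.-tuple R) (M : 'M[R]_d) : Prop :=
  forall j k, covariance P (fun w => tnth (Z w) j) (fun w => tnth (Z w) k) =
    (M j k)%:E.

(* E (U U^T) = I_d *)
Definition isotropic (d : nat) (U : T -> d.-tuple R) : Prop :=
  forall j k, 'E_P[fun w => ((vec (U w) *m (vec (U w))^T) j k)%R] =
    ((1%:M : 'M[R]_d) j k)%:E.

(* Every entry of the sample [x] has the law of [X], a random vector that may
   live on another probability space. *)
Definition copies_of (n d : nat) (x : T -> n.-tuple (d.-tuple R))
    dT' (T' : measurableType dT') (P' : probability T' R)
    (X : T' -> d.-tuple R) : Prop :=
  forall (i : 'I_n) (A : set (d.-tuple R)), measurable A ->
    P [set w | A (tnth (x w) i)] = P' (X @^-1` A).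

(* xi_1, ..., xi_n, eta_1, ..., eta_m are independent standard Gaussian
   variables, independent of the data [D]. *)
Definition gaussian_multipliers (n m : nat) dE (E : measurableType dE)
    (D : T -> E) (xi : T -> n.-tuple R) (eta : T -> m.-tuple R) : Prop :=
  [/\ mutually_independent (pooled xi eta),
      forall k V, measurable V ->
        P (pooled xi eta k @^-1` V) = normal_prob 0 1 V &
      independent2 D (fun w => (xi w, eta w))].

End Probability.

Definition two_sample_model (R : realType) (dT : measure_display)
    (T : measurableType dT) (P : probability T R) (n m d : nat)
    (x : T -> n.-tuple (d.-tuple R)) (y : T -> m.-tuple (d.-tuple R))
    (Sigma1 Sigma2 : 'M[R]_d) (L1 : R) : Prop :=
  mutually_independent P (pooled x y) /\
  exists dT' (T' : measurableType dT') (P' : probability T' R)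
    (X Y U1 U2 : {mfun T' >-> d.-tuple R}) (S1 S2 : 'M[R]_d),
    [/\ [/\ copies_of P x P' X, centered P' X & has_covmx P' X Sigma1],
        [/\ copies_of P y P' Y, centered P' Y & has_covmx P' Y Sigma2],
        [/\ centered P' U1, isotropic P' U1, centered P' U2 &
            isotropic P' U2],
        [/\ is_sqrtmx S1 Sigma1, is_sqrtmx S2 Sigma2,
            forall w, vec (X w) = S1 *m vec (U1 w) &
            forall w, vec (Y w) = S2 *m vec (U2 w)] &
        (maxe (psi2_sphere P' U1) (psi2_sphere P' U2) <= L1%:E)%E].

(* Main.v *)
(** Everything rests on two bounds that hold with probability tending to 1,
    uniformly over the alternatives: with [theta = sqrt (slog / n)], for all
    sparse unit vectors [v],
      [|v^T (hatS - S) v| <= c theta v^T S v] and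
      [|v^T (boot_cov) v| <= c theta v^T S v]
    in each of the two samples.  They give [B_max = O (sqrt slog)], hence
    [q_alpha = O (sqrt slog)] by Markov's inequality applied to the conditional
    distribution, while at a single [v] that nearly attains the supremum in the
    definition of the alternatives the statistic is at least
    [(2 / 3) (lambda / 2 - O (1)) sqrt slog]; a large [lambda] concludes.

    For a fixed [v] the squares [(v^T X_i)^2] are sub-exponential.  Bernstein's
    inequality is proved jointly in the data and in multipliers truncated at
    [1 / (2 theta)]: the truncation makes the exponent [theta] admissible, and
    [slog * ln n = o (n)] is what makes it inactive.  The union bound runs over
    integer vectors [z], to which [8 sqrt s v] is rounded coordinatewise; their
    number is bounded by a generating function.

    As probabilities of non-measurable sets are meaningless, the suprema
    defining [Q_max] and [B_max] are reduced to countably many integer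
    vectors. *)
Require Import Defs.
From HB Require Import structures.
From mathcomp Require Import all_boot all_order all_algebra.
From mathcomp Require Import all_classical all_reals all_analysis.
From mathcomp Require Import measurable_realfun ring lra.
Set Implicit Arguments.
Unset Strict Implicit.
Unset Printing Implicit Defensive.
Import Order.TTheory GRing.Theory Num.Theory.
Import numFieldNormedType.Exports.
Import HBNNSimple.

Local Open Scope classical_set_scope.
Local Open Scope ring_scope.

(** * Independence and integration *)

(** Given the data the bootstrap process is Gaussian, but its conditional variance is an average of
    fourth powers [(v^T X_i)^4], which in general have no exponential moments to feed a union bound.
    The proof freezes the multipliers instead: the process is then a weighted sum of independent
    centered sub-exponential variables. Untruncated Gaussian weights can make the joint moment
    generating function infinite, since averaging [exp (theta xi W)] over [xi] leaves
    [exp (theta^2 W^2 / 2)] with [W] merely sub-exponential. Weights up to [1 / (2 theta)] are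
    harmless, and [n] Gaussians all respect this outside a probability at most of order [n exp (- 1
    / (16 theta^2)) = n exp (- n / (16 slog))]. The net yields deviations measured by [lambda_max];
    the bounded condition number turns them into multiples of [v^T S v], so that sample and
    population denominators agree up to factors [1 / 2] and [3 / 2]. The failure probability
    [exp (- slog)] vanishes because [slog >= 1 + ln d] and [d] diverges. *)

Lemma ge0_integral_density d1 d2 (T : measurableType d1) (E : measurableType d2)
    (R : realType) (mu : {measure set T -> \bar R})
    (nu : {measure set E -> \bar R}) (V : T -> R) (Z : T -> E)
    (mV : measurable_fun [set: T] V) (V0 : forall x, 0 <= V x)
    (mZ : measurable_fun [set: T] Z)
    (nuE : forall A, measurable A ->
      nu A = (\int[mu]_x ((V x)%:E * (\1_A (Z x))%:E))%E)
    (f : E -> \bar R) (mf : measurable_fun [set: E] f)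
    (f0 : forall y, (0 <= f y)%E) :
  (\int[nu]_y f y = \int[mu]_x ((V x)%:E * f (Z x)))%E.
Proof.
pose f_ := nnsfun_approx measurableT mf.
have mfZ g : measurable_fun [set: E] g ->
    measurable_fun [set: T] (fun x => (V x)%:E * g (Z x))%E.
  by move=> mg; apply: emeasurable_funM;
    [exact/measurable_EFinP|exact: measurableT_comp].
transitivity (limn (fun n => \int[nu]_y (f_ n y)%:E))%E.
  rewrite -monotone_convergence//.
  - apply: eq_integral => y _; apply/esym/cvg_lim => //.
    exact: cvg_nnsfun_approx.
  - by move=> n; exact/measurable_EFinP/measurable_funP.
  - by move=> n y _; rewrite lee_fin.
  - by move=> y _ m n mn; rewrite lee_fin; exact/lefP/nd_nnsfun_approx.
transitivity (limn (fun n => \int[mu]_x ((V x)%:E * (f_ n (Z x))%:E)))%E.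
  congr (limn _); apply/funext => n.
  transitivity (\sum_(r \in range (f_ n))
      \int[mu]_x ((V x)%:E * (r * \1_(f_ n @^-1` [set r]) (Z x))%:E))%E.
    under eq_integral do rewrite fimfunE -fsumEFin//.
    rewrite ge0_integral_fsum//; last 2 first.
    - by move=> r; exact/measurable_EFinP/measurable_funM.
    - by move=> r x _; rewrite EFinM nnfun_muleindic_ge0.
    apply: eq_fsbigr => r _.
    rewrite integralZl_indic_nnsfun// integral_indic//= setIT.
    have [r0|r0] := leP 0 r; last first.
      rewrite preimage_nnfun0// measure0 mule0.
      by rewrite [RHS]integral0_eq// => x _; rewrite indic0 mulr0 mule0.
    rewrite nuE// -ge0_integralZl//.
    - by apply: eq_integral => x _; rewrite EFinM muleCA.
    - by apply: (mfZ (fun y => (\1_(f_ n @^-1` [set r]) y)%:E));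
        exact/measurable_EFinP.
    - by move=> x _; rewrite mule_ge0// lee_fin.
  rewrite -ge0_integral_fsum//.
  - apply: eq_integral => x _.
    rewrite fimfunE -fsumEFin// ge0_mule_fsumr// => r.
    by rewrite EFinM nnfun_muleindic_ge0.
  - move=> r; apply: (mfZ (fun y => (r * \1_(f_ n @^-1` [set r]) y)%:E)).
    by apply/measurable_EFinP/measurable_funM.
  - move=> r x _; apply: mule_ge0; first by rewrite lee_fin.
    by rewrite EFinM nnfun_muleindic_ge0.
rewrite -monotone_convergence//.
- apply: eq_integral => x _; apply/cvg_lim => //.
  by apply: cvgeZl => //; apply: cvg_nnsfun_approx.
- by move=> n; apply: (mfZ (fun y => (f_ n y)%:E)); apply/measurable_EFinP.
- by move=> n x _; apply: mule_ge0; rewrite lee_fin.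
- move=> x _ m n mn; apply: lee_wpmul2l; first by rewrite lee_fin.
  by rewrite lee_fin; exact/lefP/nd_nnsfun_approx.
Qed.

Lemma integral_indic_preimage d1 d2 (T : measurableType d1)
    (E : measurableType d2) (R : realType) (P : {measure set T -> \bar R})
    (Z : {mfun T >-> E}) (A : set E) (mA : measurable A) :
  (\int[P]_w (\1_A (Z w))%:E = P (Z @^-1` A))%E.
Proof.
have mZA : measurable (Z @^-1` A) by exact: measurable_funPTI.
by rewrite -[in RHS](setIT (Z @^-1` A)) -integral_indic.
Qed.

Lemma integral_prod_independent d1 d2 (T : measurableType d1)
    (E : measurableType d2) (R : realType) (P : probability T R) (I : finType)
    (Z : I -> {mfun T >-> E}) (indZ : mutually_independent P (fun i =>
      Z i : T -> E))
    (f : I -> E -> R) (mf : forall i, measurable_fun [set: E] (f i))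
    (f0 : forall i y, 0 <= f i y)
    (ff : forall i, (\int[P]_w (f i (Z i w))%:E < +oo)%E) :
  (\int[P]_w (\prod_i f i (Z i w))%:E =
   (\prod_i fine (\int[P]_w (f i (Z i w))%:E))%:E)%E.
Proof.
pose ind (g : I -> E -> R) i := exists2 A, measurable A & g i = \1_A.
(* The list [s] holds the indices whose factor may fail to be an indicator. *)
suff: forall s : seq I, (forall i, i \notin s -> ind f i) ->
    (\int[P]_w (\prod_i f i (Z i w))%:E =
     (\prod_i fine (\int[P]_w (f i (Z i w))%:E))%:E)%E.
  by move=> /(_ (enum I)); apply => i; rewrite mem_enum.
move=> s; elim: s f mf f0 ff => [|i s IH] f mf f0 ff inds.
  have /choice[A AP] : forall i, exists A, measurable A /\ f i = \1_A.
    by move=> i; have [A mA fA] := inds i isT; exists A.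
  have mA i : measurable (Z i @^-1` A i).
    by apply: measurable_funPTI; have [] := AP i.
  have fE i : (\int[P]_w (f i (Z i w))%:E = P (Z i @^-1` A i))%E.
    by rewrite (AP i).2 integral_indic_preimage//; have [] := AP i.
  have -> : (fun w => (\prod_i f i (Z i w))%:E) =
      EFin \o \1_(\bigcap_(i in [set: I]) (Z i @^-1` A i)).
    apply/funext => w /=; congr (_%:E); rewrite indicE.
    have [/[!inE] wA|/negP wA] := boolP (_ \in _).
      rewrite big1// => i _; rewrite (AP i).2 indicE mem_set//.
      exact: wA.
    have [i nA] : exists i, ~ A i (Z i w).
      by apply/existsNP => wA'; apply: wA; rewrite inE => i _; exact: wA'.
    by rewrite (bigD1 i)//= (AP i).2 indicE memNset// mul0r.
  rewrite integral_indic//; last exact: fin_bigcap_measurable.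
  rewrite setIT [LHS](indZ A); last by move=> i; have [] := AP i.
  rewrite (big_morph EFin (@EFinM R) erefl); apply: eq_bigr => i _.
  by rewrite fineK ?fE// fin_num_measure.
pose c := \prod_(j | j != i) fine (\int[P]_w (f j (Z j w))%:E).
have c0 : 0 <= c.
  by apply: prodr_ge0 => j _; apply/fine_ge0/integral_ge0 => w _;
    rewrite lee_fin.
pose V w := \prod_(j | j != i) f j (Z j w).
have mV : measurable_fun [set: T] V.
  rewrite /V; under eq_fun do rewrite -big_filter.
  by apply: measurable_prod => j _; exact: measurableT_comp.
have V0 w : 0 <= V w by apply: prodr_ge0.
pose nu : {measure set E -> \bar R} :=
  mscale (NngNum c0) (distribution P (Z i)).
have nuE A : measurable A -> nu A = (\int[P]_w ((V w)%:E * (\1_A (Z i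
  w))%:E))%E.
  move=> mA; pose g j := if j == i then \1_A else f j.
  have gi : g i = \1_A by rewrite /g eqxx.
  have gN j : j != i -> g j = f j by rewrite /g => /negbTE ->.
  have gint j : (\int[P]_w (g j (Z j w))%:E < +oo)%E.
    have [->|ji] := eqVneq j i; last by rewrite gN.
    by rewrite gi integral_indic_preimage// ltey_eq fin_num_measure//;
      exact: measurable_funPTI.
  transitivity (\int[P]_w (\prod_j g j (Z j w))%:E)%E; last first.
    apply: eq_integral => w _; rewrite (bigD1 i)//= gi mulrC EFinM.
    by congr (_%:E * _)%E; apply: eq_bigr => j /gN ->.
  rewrite IH//.
  - rewrite (bigD1 i)//= gi integral_indic_preimage// mulrC EFinM fineK;
      last first.
      by rewrite fin_num_measure//; exact: measurable_funPTI.
    rewrite /nu /mscale/=; congr (_%:E * _)%E.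
    by rewrite /c; apply: eq_bigr => j /gN ->.
  - by move=> j; rewrite /g; case: eqP.
  - by move=> j y; rewrite /g; case: eqP.
  - move=> j js; have [->|ji] := eqVneq j i; first by exists A.
    have [|B mB fB] := inds j; first by rewrite inE negb_or ji.
    by exists B => //; rewrite gN.
transitivity (\int[P]_w ((V w)%:E * (f i (Z i w))%:E))%E.
  apply: eq_integral => w _; rewrite (bigD1 i)//= mulrC EFinM.
  by [].
rewrite -(ge0_integral_density mV V0 _ nuE (f := EFin \o f i))//; last first.
- by move=> y; rewrite lee_fin.
- exact/measurable_EFinP.
rewrite ge0_integral_mscale//; last first.
- by move=> y _; rewrite lee_fin.
- exact/measurable_EFinP.
rewrite ge0_integral_distribution//; last first.
- by move=> y; rewrite lee_fin.
- exact/measurable_EFinP.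
rewrite (bigD1 i)//= mulrC EFinM fineK// ge0_fin_numE//.
by apply: integral_ge0 => w _; rewrite lee_fin.
Qed.

(** The joint law is the product of the marginals, and Tonelli applies. The order matters later: the
    inner integral runs over the data while the multipliers stay frozen at [w']. *)
Lemma integral_independent2 d d1 d2 (T : measurableType d)
    (E1 : measurableType d1) (E2 : measurableType d2) (R : realType)
    (P : probability T R) (X : {mfun T >-> E1}) (Y : {mfun T >-> E2})
    (XY : independent2 P X Y) (f : E1 * E2 -> \bar R)
    (mf : measurable_fun [set: E1 * E2] f) (f0 : forall z, (0 <= f z)%E) :
  (\int[P]_w f (X w, Y w) = \int[P]_w' \int[P]_w f (X w, Y w'))%E.
Proof.
have mXY : measurable_fun [set: T] (fun w => (X w, Y w)).
  exact: measurable_fun_pair.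
pose XYm : {mfun T >-> (E1 * E2)%type} := mfun_Sub (mem_set mXY).
have mXYE A : measurable A ->
    (distribution P X \x distribution P Y)%E A = distribution P XYm A.
  have XYE B C : measurable B -> measurable C -> distribution P XYm (B `*` C) =
      (distribution P X B * distribution P Y C)%E by exact: XY.
  exact: (@product_measure_unique _ _ _ _ R (distribution P X)
    (distribution P Y) (distribution P XYm) XYE A).
rewrite -(ge0_integral_distribution XYm mf f0)/=.
transitivity (\int[(distribution P X \x distribution P Y)%E]_z f z)%E.
  apply: eq_measure_integral => A mA _; first [exact/esym/mXYE|exact: mXYE].
rewrite fubini_tonelli2///= /fubini_G.
rewrite ge0_integral_distribution//=.
- apply: eq_integral => w' _; rewrite ge0_integral_distribution//.
  exact: measurable_fun_pair1.
- exact: measurable_fun_fubini_tonelli_G.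
- by move=> y; apply: integral_ge0.
Qed.

Lemma ge0_integral_normal (R : realType) (m s : R)
    (nu : {measure set R -> \bar R})
    (nuE : forall V, measurable V -> nu V = normal_prob m s V)
    (f : R -> \bar R) (mf : measurable_fun [set: R] f)
    (f0 : forall y, (0 <= f y)%E) :
  (\int[nu]_y f y =
   \int[lebesgue_measure]_x ((normal_pdf m s x)%:E * f x))%E.
Proof.
apply: (@ge0_integral_density _ _ _ _ R lebesgue_measure nu
  (normal_pdf m s) id) => //.
- exact: measurable_normal_pdf.
- by move=> x; exact: normal_pdf_ge0.
- move=> A mA; rewrite nuE// /normal_prob [LHS]integral_mkcond/=.
  by apply: eq_integral => x _; rewrite patchE indicE; case: ifP => _;
    rewrite ?mule1 ?mule0.
Qed.

(** [exp (x^2 / 4)] times the standard Gaussian density is [sqrt 2] times the centered Gaussian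
    density of variance 2. *)
Lemma integral_normal_expR_sqr (R : realType) (nu : {measure set R -> \bar R})
    (nuE : forall V, measurable V -> nu V = normal_prob 0 1 V) :
  (\int[nu]_x (expR (x ^+ 2 / 4))%:E = (Num.sqrt 2)%:E)%E.
Proof.
have m4 : measurable_fun [set: R] (fun x : R => expR (x ^+ 2 / 4)).
  by apply: measurableT_comp => //; exact: measurable_funM.
rewrite (ge0_integral_normal nuE); [|exact/measurable_EFinP|]; last first.
  by move=> x; rewrite lee_fin expR_ge0.
have s20 : Num.sqrt (2 : R) != 0 by rewrite gt_eqF// sqrtr_gt0.
transitivity (\int[lebesgue_measure]_x ((Num.sqrt 2)%:E * (normal_pdf 0
  (Num.sqrt 2 : R) x)%:E))%E.
  apply: eq_integral => x _; rewrite -!EFinM; congr (_%:E).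
  rewrite !normal_pdfE// /normal_fun -[LHS]mulrA -expRD.
  rewrite /normal_peak sqr_sqrtr// expr1n mul1r subr0 mulrA; congr (_ * expR _).
    by rewrite -mulrnAr sqrtrM// invfM mulrA divff ?mul1r.
  by field.
rewrite ge0_integralZl_EFin ?sqrtr_ge0//.
- by rewrite integral_normal_pdf mule1.
- by move=> x _; rewrite lee_fin; exact: normal_pdf_ge0.
- exact: (measurable_int _ (integrable_normal_pdf _ _)).
Qed.

(** * Bernstein's inequality *)

Lemma expR_le_quadratic (R : realType) (y : R) :
  expR y <= 1 + y + y ^+ 2 * expR `|y|.
Proof.
have [y0|y0] := leP 0 y.
  have h : expR y - 1 <= y * expR y.
    have := expR_ge1Dx (- y); rewrite -(ler_pM2r (expR_gt0 y)) -expRD addNr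
      expR0.
    lra.
  rewrite ger0_norm// expr2 -mulrA.
  have : y * (expR y - 1) <= y * (y * expR y) by rewrite ler_wpM2l.
  lra.
have y1 : 1 <= expR `|y| by rewrite -expR0 ler_expR.
have h : expR y * (1 - y) <= 1.
  have := expR_ge1Dx (- y); rewrite -(ler_pM2l (expR_gt0 y)) -expRD subrr expR0.
  by [].
have : y ^+ 2 <= y ^+ 2 * expR `|y| by rewrite ler_peMr// sqr_ge0.
(* For negative [y], multiplying by [1 - y > 0] reduces this to
   [exp y * (1 - y) <= 1 <= 1 - y^3]. *)
have : expR y <= 1 + y + y ^+ 2; last by lra.
rewrite -(@ler_pM2r _ (1 - y)); last by lra.
apply: (le_trans h); have : 0 <= y ^+ 2 * - y by rewrite mulr_ge0 ?sqr_ge0//;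
  lra.
nra.
Qed.

Lemma sqr_le_expR (R : realType) (x : R) : x ^+ 2 <= 16 * expR (`|x| / 2).
Proof.
have h := expR_ge1Dx (`|x| / 4).
have -> : `|x| / 2 = `|x| / 4 + `|x| / 4 by field.
rewrite expRD -[x ^+ 2]real_normK ?num_real//.
have : `|x| / 4 <= expR (`|x| / 4) by lra.
move: (normr_ge0 x) (expR_gt0 (`|x| / 4)); nra.
Qed.

(** The linear term of the quadratic bound has mean zero. In the remainder, [D = W - w0] satisfies
    [D^2 <= 16 exp (|D| / 2)], and [|tau| <= 1 / 2] leaves another [exp (|D| / 2)]; together they
    are at most [16 exp (w0 + W)]. As [w0 <= 1] and [exp W] has mean at most 2, the constant is
    [16 * e * 2]. *)
Lemma mgf_centered d (T : measurableType d) (R : realType)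
    (P : probability T R) (W : T -> R) (w0 tau : R)
    (mW : measurable_fun [set: T] W) (W0 : forall w, 0 <= W w)
    (W2 : (\int[P]_w (expR (W w))%:E <= 2%:E)%E)
    (Ww0 : (\int[P]_w (W w)%:E = w0%:E)%E) (htau : `|tau| <= 1 / 2) :
  (\int[P]_w (expR (tau * (W w - w0)))%:E
    <= (1 + 32 * expR 1 * tau ^+ 2)%:E)%E.
Proof.
have mE : measurable_fun [set: T] (fun w => expR (W w)).
  exact: measurableT_comp.
have w00 : 0 <= w0 by rewrite -lee_fin -Ww0 integral_ge0// => w _;
  rewrite lee_fin.
(* This is [1 + W <= exp W], integrated. *)
have w01 : w0 <= 1.
  have : (1 + w0%:E <= 2%:E)%E; last by rewrite -EFinD lee_fin; lra.
  apply: le_trans W2.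
  rewrite -Ww0 -(probability_setT P) -[P _]mul1e -integral_cst//.
  rewrite -ge0_integralD//; last 2 first.
    by move=> w _; rewrite lee_fin.
    exact/measurable_EFinP.
  apply: ge0_le_integral => //.
  - by move=> w _; rewrite -EFinD lee_fin addr_ge0.
  - by apply: emeasurable_funD => //; exact/measurable_EFinP.
  - exact/measurable_EFinP.
  - by move=> w _; rewrite -EFinD lee_fin expR_ge1Dx.
have iE : P.-integrable [set: T] (fun w => (expR (W w))%:E).
  apply/integrableP; split; first exact/measurable_EFinP.
  apply: le_lt_trans (ltry 2); under eq_integral do rewrite gee0_abs ?lee_fin
    ?expR_ge0//.
  by [].
have iW : P.-integrable [set: T] (fun w => (W w)%:E).
  apply/integrableP; split; first exact/measurable_EFinP.
  under eq_integral do rewrite gee0_abs ?lee_fin//.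
  by rewrite Ww0 ltry.
pose K := 16 * tau ^+ 2 * expR w0.
have K0 : 0 <= K by apply: mulr_ge0 (expR_ge0 _); apply: mulr_ge0 (sqr_ge0 _).
have key w : expR (tau * (W w - w0)) <= (1 - tau * w0) + tau * W w + K * expR
  (W w).
  set D := W w - w0.
  have Dle : `|D| <= w0 + W w by rewrite (le_trans (ler_normB _ _))//
    !ger0_norm// addrC.
  have tD : `|tau * D| <= `|D| / 2.
    by rewrite normrM mulrC ler_wpM2l//; lra.
  apply: le_trans (expR_le_quadratic _) _.
  have -> : 1 - tau * w0 + tau * W w = 1 + tau * D by rewrite /D; ring.
  have DE : D ^+ 2 * expR `|tau * D| <= 16 * (expR w0 * expR (W w)).
    apply: (@le_trans _ _ (16 * expR (`|D| / 2) * expR (`|D| / 2))).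
      by apply: ler_pM; rewrite ?sqr_ge0 ?expR_ge0 ?sqr_le_expR ?ler_expR.
    by rewrite -mulrA -!expRD ler_wpM2l// ler_expR; lra.
  have -> : (tau * D) ^+ 2 * expR `|tau * D| =
            tau ^+ 2 * (D ^+ 2 * expR `|tau * D|) by ring.
  have -> : K * expR (W w) = tau ^+ 2 * (16 * (expR w0 * expR (W w))).
    by rewrite /K; ring.
  by apply: lerD => //; apply: ler_wpM2l => //; exact: sqr_ge0.
apply: (@le_trans _ _ (\int[P]_w ((1 - tau * w0)%:E + tau%:E * (W w)%:E + K%:E
  * (expR (W w))%:E))%E).
  apply: ge0_le_integral => //.
  - apply/measurable_EFinP; apply: measurableT_comp => //.
    by apply: measurable_funM => //; exact: measurable_funB.
  - by repeat (apply: emeasurable_funD => // || apply: emeasurable_funM =>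
      // || apply/measurable_EFinP => //).
  - by move=> w _; rewrite -!EFinM -!EFinD lee_fin.
have i1 : P.-integrable [set: T] (fun=> (1 - tau * w0)%:E).
  exact: finite_measure_integrable_cst.
have i2 : P.-integrable [set: T] (fun w => tau%:E * (W w)%:E)%E.
  exact: integrableZl.
have i3 : P.-integrable [set: T] (fun w => K%:E * (expR (W w))%:E)%E.
  exact: integrableZl.
rewrite integralD//; last exact: integrableD.
rewrite integralD// integral_cst// !integralZl// Ww0.
rewrite [X in (_ * X + _ + _)%E]probability_setT mule1.
apply: (@le_trans _ _ ((1 - tau * w0)%:E + tau%:E * w0%:E + K%:E * 2%:E)%E).
  by apply: leeD2l; apply: lee_wpmul2l; rewrite ?lee_fin.
rewrite -!EFinM -!EFinD lee_fin /K.
have : expR w0 <= expR 1 by rewrite ler_expR.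
have : 0 <= tau ^+ 2 by rewrite sqr_ge0.
nra.
Qed.

Lemma measurable_exists_fin d (T : measurableType d) (F : finType)
    (G : {set F}) (A : F -> set T) (mA : forall z, measurable (A z)) :
  measurable [set w | exists2 z, z \in G & A z w].
Proof.
have -> : [set w | exists2 z, z \in G & A z w] =
    \bigcup_(z in [set` G]) A z.
  by apply/seteqP; split => w /= [z ? ?]; exists z.
by apply: fin_bigcup_measurable.
Qed.

Lemma measurable_exceed d (T : measurableType d) (R : realType) (F : finType)
    (G : {set F}) (S : F -> T -> R) (t : R)
    (mS : forall z, measurable_fun [set: T] (S z)) :
  measurable [set w | exists2 z, z \in G & t < `|S z w|].
Proof.
apply: (@measurable_exists_fin _ _ F G (fun z => [set w | t < `|S z w|])) => z.
have -> : [set w | t < `|S z w|] = (fun w => `|S z w|) @^-1` `]t, +oo[%classic.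
  by apply/seteqP; split => w /=; rewrite in_itv/= andbT.
by rewrite -[X in measurable X]setTI; apply: measurableT_comp.
Qed.

(** The indicator of the event is at most the sum over [G] of [exp (- theta t) (exp (theta S) + exp
    (- theta S))]. Besides the lattice points, [F] will be the index set of a sample and the
    one-point type. *)
Lemma union_chernoff d (T : measurableType d) (R : realType)
    (P : probability T R) (F : finType) (G : {set F}) (S : F -> T -> R)
    (mS : forall z, measurable_fun [set: T] (S z)) (theta A t : R)
    (theta0 : 0 <= theta)
    (hp : forall z, z \in G ->
      (\int[P]_w (expR (theta * S z w))%:E <= (expR A)%:E)%E)
    (hn : forall z, z \in G ->
      (\int[P]_w (expR (- theta * S z w))%:E <= (expR A)%:E)%E) :
  (P [set w | exists2 z, z \in G & (t < `|S z w|)%R]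
    <= (#|G|%:R * (2 * expR (A - theta * t)))%:E)%E.
Proof.
have mB := measurable_exceed G t mS.
set B := (X in P X) in mB *.
pose E e z w := expR (e * S z w).
have mE e z : measurable_fun [set: T] (E e z).
  by apply: measurableT_comp => //; exact: measurable_funM.
pose f z w := (expR (- theta * t) * (E theta z w + E (- theta) z w))%:E.
have mf z : measurable_fun [set: T] (f z).
  by apply/measurable_EFinP; apply: measurable_funM => //;
    exact: measurable_funD.
have f0 z w : (0 <= f z w)%E.
  by rewrite lee_fin mulr_ge0 ?addr_ge0 ?expR_ge0.
apply: (@le_trans _ _ (\int[P]_w (\sum_(z <- enum G) f z w))%E).
  have -> : P B = (\int[P]_w (\1_B w)%:E)%E by rewrite integral_indic// setIT.
  apply: ge0_le_integral => //.
  - exact/measurable_EFinP.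
  - exact: emeasurable_sum.
  move=> w _; rewrite indicE.
  have [/[!inE] -[z zG tS]|_] := boolP (w \in _); last exact: sume_ge0.
  rewrite (bigD1_seq z) ?mem_enum ?enum_uniq//= -[leLHS]adde0 leeD//;
    last exact: sume_ge0.
  rewrite lee_fin mulrDr -!expRD.
  have [S0|S0] := leP 0 (S z w).
  - rewrite -[leLHS]addr0 lerD ?expR_ge0// -[leLHS]expR0 ler_expR.
    rewrite ger0_norm// in tS.
    by have := ler_wpM2l theta0 (ltW tS); lra.
  - rewrite -[leLHS]add0r lerD ?expR_ge0// -[leLHS]expR0 ler_expR.
    rewrite ltr0_norm// in tS.
    by have := ler_wpM2l theta0 (ltW tS); lra.
rewrite ge0_integral_sum//.
apply: (@le_trans _ _ (\sum_(z <- enum G) (2 * expR (A - theta * t))%:E)%E).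
  rewrite big_seq [leRHS]big_seq; apply: lee_sum => z; rewrite mem_enum => zG.
  under eq_integral do rewrite /f EFinM.
  rewrite ge0_integralZl//; last 2 first.
  - by apply/measurable_EFinP; exact: measurable_funD.
  - by move=> w _; rewrite lee_fin addr_ge0 ?expR_ge0.
  under eq_integral do rewrite EFinD.
  rewrite ge0_integralD//; last 4 first.
  - by move=> w _; rewrite lee_fin expR_ge0.
  - exact/measurable_EFinP.
  - by move=> w _; rewrite lee_fin expR_ge0.
  - exact/measurable_EFinP.
  apply: (@le_trans _ _ ((expR (- theta * t))%:E * ((expR A)%:E + (expR
    A)%:E))%E).
    apply: lee_wpmul2l; first by rewrite lee_fin expR_ge0.
    by apply: leeD; [exact: hp|exact: hn].
  by rewrite -EFinD -EFinM lee_fin expRD mulNr; lra.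
by rewrite sumEFin lee_fin big_const_seq count_predT -cardE iter_addr_0
  -[leLHS]mulr_natl.
Qed.

Lemma measurable_coord d1 d2 (T : measurableType d1) (E : measurableType d2)
    (n : nat) (x : {mfun T >-> n.-tuple E}) (i : 'I_n) :
  measurable_fun [set: T] (fun w => tnth (x w) i).
Proof. by apply: (measurableT_comp (measurable_tnth i)). Qed.

Definition coord d1 d2 (T : measurableType d1) (E : measurableType d2)
    (n : nat) (x : {mfun T >-> n.-tuple E}) (i : 'I_n) : {mfun T >-> E} :=
  mfun_Sub (mem_set (measurable_coord x i)).

(** Truncated multipliers are never recentered: the centering is supplied by the data factor they
    multiply. *)
Definition trunc (R : realType) (b x : R) : R := if `|x| <= b then x else 0.

Lemma measurable_trunc (R : realType) (b : R) : measurable_fun [set: R] (trunc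
  b).
Proof.
apply: measurable_fun_ifT => //.
by apply: measurable_fun_ler => //; exact: measurableT_comp.
Qed.

Lemma trunc_le (R : realType) (b x : R) : 0 <= b -> `|trunc b x| <= b.
Proof. by move=> b0; rewrite /trunc; case: ifP => //; rewrite normr0. Qed.

Lemma sqr_trunc_le (R : realType) (b x : R) : trunc b x ^+ 2 <= x ^+ 2.
Proof. by rewrite /trunc; case: ifP => // _; rewrite expr0n/= sqr_ge0. Qed.

(** The weights are deterministic here: later they are all equal to 1, or they are the truncated
    multipliers frozen at one outcome. *)
Lemma mgf_weighted_sum d1 d2 (T : measurableType d1) (E : measurableType d2)
    (R : realType) (P : probability T R) (n : nat) (x : {mfun T >-> n.-tuple E})
    (indx : mutually_independent P (fun i w => tnth (x w) i))
    (W : E -> R) (w0 : R) (mW : measurable_fun [set: E] W)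
    (W0 : forall y, 0 <= W y)
    (W2 : forall i, (\int[P]_w (expR (W (tnth (x w) i)))%:E <= 2%:E)%E)
    (Ww0 : forall i, (\int[P]_w (W (tnth (x w) i))%:E = w0%:E)%E)
    (a : 'I_n -> R) (theta : R) (ha : forall i, `|theta * a i| <= 1 / 2) :
  (\int[P]_w (expR (theta * \sum_i a i * (W (tnth (x w) i) - w0)))%:E
    <= (\prod_i (1 + 32 * expR 1 * (theta * a i) ^+ 2))%:E)%E.
Proof.
pose f i (y : E) := expR (theta * a i * (W y - w0)).
have mf i : measurable_fun [set: E] (f i).
  apply: measurableT_comp => //; apply: measurable_funM => //.
  exact: measurable_funB.
have fle i : (\int[P]_w (f i (coord x i w))%:E <=
    (1 + 32 * expR 1 * (theta * a i) ^+ 2)%:E)%E.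
  apply: (@mgf_centered _ _ _ P (W \o coord x i)) => //.
  - exact: measurableT_comp.
  - by move=> w; exact: W0.
  - exact: W2.
  - exact: Ww0.
have f0 : forall i y, 0 <= f i y by move=> i y; exact: expR_ge0.
have ff i : (\int[P]_w (f i (coord x i w))%:E < +oo)%E.
  exact: le_lt_trans (fle i) (ltry _).
have := @integral_prod_independent _ _ T E R P _ (coord x) indx f mf f0 ff.
have -> : (fun w => (\prod_i f i (coord x i w))%:E) =
    fun w => (expR (theta * \sum_i a i * (W (tnth (x w) i) - w0)))%:E.
  apply/funext => w; congr (_%:E).
  by rewrite mulr_sumr expR_sum; apply: eq_bigr => i _; rewrite mulrA.
move=> ->; rewrite lee_fin; apply: ler_prod => i _; apply/andP; split.
  by apply/fine_ge0/integral_ge0 => w _; rewrite lee_fin.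
rewrite -lee_fin fineK// ge0_fin_numE//.
by apply: integral_ge0 => w _; rewrite lee_fin.
Qed.

Lemma integral_normal_quadratic (R : realType) (nu : probability R R)
    (nuE : forall V, measurable V -> nu V = normal_prob 0 1 V)
    (c : R) (c0 : 0 <= c) :
  (\int[nu]_x (1 + c * x ^+ 2)%:E <= (1 + 8 * c)%:E)%E.
Proof.
have m2 : measurable_fun [set: R] (fun x : R =>
  x ^+ 2) by exact: exprn_measurable.
have mE : measurable_fun [set: R] (fun x : R => (expR (x ^+ 2 / 4))%:E).
  by apply/measurable_EFinP; apply: measurableT_comp => //;
    exact: measurable_funM.
(* [x^2 <= 4 exp (x^2 / 4)], and the Gaussian mean of the right side is [4 sqrt 2 <= 8]. *)
apply: (@le_trans _ _ (\int[nu]_x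
    (1%:E + (4 * c)%:E * (expR (x ^+ 2 / 4))%:E))%E).
  apply: ge0_le_integral => //.
  - by move=> x _; rewrite lee_fin addr_ge0// mulr_ge0// sqr_ge0.
  - by apply/measurable_EFinP; apply: measurable_funD => //;
      exact: measurable_funM.
  - by apply: emeasurable_funD => //; exact: emeasurable_funM.
  move=> x _; rewrite -EFinM -EFinD lee_fin lerD2l.
  have := expR_ge1Dx (x ^+ 2 / 4).
  by have := ler_wpM2l c0 (expR_ge1Dx (x ^+ 2 / 4)); lra.
have c40 : 0 <= 4 * c by lra.
rewrite ge0_integralD//; last 2 first.
  by move=> x _; rewrite -EFinM lee_fin mulr_ge0// expR_ge0.
  exact: emeasurable_funM.
rewrite ge0_integralZl_EFin//.
rewrite (integral_normal_expR_sqr nuE) integral_cst// mul1e.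
rewrite [X in (X + _)%E]probability_setT -EFinM -EFinD lee_fin.
have : Num.sqrt 2 <= 2 :> R.
  have := sqr_sqrtr (ler0n R 2); move: (sqrtr_ge0 (2 : R)); nra.
nra.
Qed.

(** With the multipliers frozen, truncation keeps the absolute value of every [theta * trunc b xi_i]
    below [1 / 2], so integrating the data gives at most a product of factors
    [1 + 32 e theta^2 xi_i^2]. By independence of the multipliers each factor averages to at most
    [1 + 8 * 32 e theta^2], whence 256. *)
Lemma mgf_multiplier d1 d2 (T : measurableType d1) (E : measurableType d2)
    (R : realType) (P : probability T R) (n : nat) (x : {mfun T >-> n.-tuple E})
    (xi : {mfun T >-> n.-tuple R})
    (indx : mutually_independent P (fun i w => tnth (x w) i))
    (indxi : mutually_independent P (fun i w => tnth (xi w) i))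
    (x_xi : independent2 P x xi)
    (nxi : forall i V, measurable V ->
      P [set w | V (tnth (xi w) i)] = normal_prob 0 1 V)
    (W : E -> R) (w0 : R) (mW : measurable_fun [set: E] W)
    (W0 : forall y, 0 <= W y)
    (W2 : forall i, (\int[P]_w (expR (W (tnth (x w) i)))%:E <= 2%:E)%E)
    (Ww0 : forall i, (\int[P]_w (W (tnth (x w) i))%:E = w0%:E)%E)
    (theta b : R) (b0 : 0 <= b) (hb : `|theta| * b <= 1 / 2) :
  (\int[P]_w (expR (theta *
       \sum_i trunc b (tnth (xi w) i) * (W (tnth (x w) i) - w0)))%:E
    <= (expR (256 * expR 1 * theta ^+ 2 * n%:R))%:E)%E.
Proof.
pose F (z : n.-tuple E * n.-tuple R) := (expR (theta *
  \sum_i trunc b (tnth z.2 i) * (W (tnth z.1 i) - w0)))%:E.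
have mF : measurable_fun [set: n.-tuple E * n.-tuple R] F.
  apply/measurable_EFinP; apply: measurableT_comp => //.
  apply: measurable_funM => //; apply: measurable_sum => i.
  apply: measurable_funM.
    apply: measurableT_comp; first exact: measurable_trunc.
    by apply: (measurableT_comp (measurable_tnth i)).
  apply: measurable_funB => //; apply: measurableT_comp => //.
  by apply: (measurableT_comp (measurable_tnth i)).
have F0 z : (0 <= F z)%E by rewrite lee_fin expR_ge0.
rewrite (integral_independent2 x_xi mF F0).
pose c := 32 * expR 1 * theta ^+ 2.
have c0 : 0 <= c by apply: mulr_ge0 (sqr_ge0 _); apply: mulr_ge0 (expR_ge0 _).
pose g (i : 'I_n) (u : R) := 1 + c * u ^+ 2.
have mg i : measurable_fun [set: R] (g i).
  by apply: measurable_funD => //; apply: measurable_funM => //;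
    exact: exprn_measurable.
have g0 : forall i u, 0 <= g i u.
  by move=> i u; rewrite addr_ge0// mulr_ge0// sqr_ge0.
have gle i : (\int[P]_w (g i (coord xi i w))%:E <= (1 + 8 * c)%:E)%E.
  rewrite -(ge0_integral_distribution _ (f := EFin \o g i))//; last 2 first.
    exact/measurable_EFinP.
    by move=> u; rewrite lee_fin.
  by apply: integral_normal_quadratic => // V mV; exact: nxi.
have gf i : (\int[P]_w (g i (coord xi i w))%:E < +oo)%E.
  exact: le_lt_trans (gle i) (ltry _).
apply: (@le_trans _ _ (\int[P]_w (\prod_i g i (coord xi i w))%:E)%E).
  apply: ge0_le_integral => //.
  - by move=> w _; exact: integral_ge0.
  - apply: (@measurable_fun_fubini_tonelli_G _ _ T T R P
      (fun z => F (x z.1, xi z.2))) => //.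
    apply: (measurableT_comp mF); apply: measurable_fun_pair;
      exact: measurableT_comp.
  - apply/measurable_EFinP; apply: measurable_prod => i _.
    exact: (measurableT_comp (mg i) (measurable_coord xi i)).
  move=> w _.
  have ha i : `|theta * trunc b (tnth (xi w) i)| <= 1 / 2.
    by rewrite normrM; apply: le_trans hb; apply: ler_wpM2l => //;
      exact: trunc_le.
  have := mgf_weighted_sum indx mW W0 W2 Ww0 ha; move/le_trans; apply.
  rewrite lee_fin; apply: ler_prod => i _; apply/andP; split.
    by rewrite addr_ge0// mulr_ge0 ?sqr_ge0// mulr_ge0// expR_ge0.
  rewrite /g lerD2l /c exprMn mulrA; apply: ler_wpM2l => //.
  exact: sqr_trunc_le.
rewrite (@integral_prod_independent _ _ T R R P _ (coord xi) indxi g mg g0 gf).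
rewrite lee_fin.
apply: (@le_trans _ _ (\prod_(i < n) expR (8 * c))).
  apply: ler_prod => i _; apply/andP; split.
    by apply/fine_ge0/integral_ge0 => w _; rewrite lee_fin.
  apply: le_trans (expR_ge1Dx _).
  rewrite -lee_fin fineK// ge0_fin_numE//.
  by apply: integral_ge0 => w _; rewrite lee_fin.
rewrite -expR_sum sumr_const card_ord ler_expR /c -mulr_natr; lra.
Qed.

(** * Quadratic forms on sparse vectors *)

Definition sqn (R : realType) (d : nat) (v : 'cV[R]_d) : R := \sum_j v j 0 ^+ 2.

Definition bform (R : realType) (d : nat) (M : 'M[R]_d) (u v : 'cV[R]_d) : R :=
  (u^T *m M *m v) 0 0.

Lemma sqn_ge0 (R : realType) (d : nat) (v : 'cV[R]_d) : 0 <= sqn v.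
Proof. by apply: sumr_ge0 => j _; exact: sqr_ge0. Qed.

Lemma sqn_eq0 (R : realType) (d : nat) (v : 'cV[R]_d) : (sqn v == 0) = (v == 0).
Proof.
apply/idP/eqP => [|->]; last first.
  by rewrite /sqn big1// => j _; rewrite mxE expr0n.
rewrite psumr_eq0; last by move=> *; exact: sqr_ge0.
move=> /allP v0; apply/matrixP => j i; rewrite ord1 mxE; apply/eqP.
by rewrite -sqrf_eq0; apply: v0; rewrite mem_index_enum.
Qed.

Lemma sqnZ (R : realType) (d : nat) (c : R) (v : 'cV[R]_d) :
  sqn (c *: v) = c ^+ 2 * sqn v.
Proof.
by rewrite /sqn mulr_sumr; apply: eq_bigr => j _; rewrite mxE exprMn.
Qed.

Lemma sparse_sphereP (R : realType) (s d : nat) (v : 'cV[R]_d) :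
  @sparse_sphere R s d v <-> sqn v = 1 /\ (norm0 v <= s)%N.
Proof.
split=> -[v1 vs]; split=> //.
  rewrite -(expr1n _ 2) -v1 /norm2 sqr_sqrtr//; exact: sqn_ge0.
by rewrite /norm2 -/(sqn v) v1 sqrtr1.
Qed.

Lemma norm0Z (R : realType) (d : nat) (c : R) (v : 'cV[R]_d) :
  (norm0 (c *: v) <= norm0 v)%N.
Proof.
apply/subset_leq_card/fintype.subsetP => j; rewrite !inE mxE; apply: contra =>
  /eqP ->.
by rewrite mulr0.
Qed.

Lemma sparse_normalize (R : realType) (s d : nat) (v : 'cV[R]_d)
    (c := (Num.sqrt (sqn v))^-1) : v != 0 -> (norm0 v <= s)%N ->
  c ^+ 2 = (sqn v)^-1 /\ @sparse_sphere R s d (c *: v).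
Proof.
move=> v0 vs; have v_gt0 : 0 < sqn v by rewrite lt0r sqn_eq0 v0 sqn_ge0.
have c2 : c ^+ 2 = (sqn v)^-1 by rewrite exprVn sqr_sqrtr// ltW.
split => //; apply/sparse_sphereP; rewrite sqnZ c2 mulVf ?gt_eqF//; split => //.
exact: leq_trans (norm0Z _ _) vs.
Qed.

Lemma norm0_le (R : realType) (d : nat) (u v : 'cV[R]_d) :
  (forall j, v j 0 = 0 -> u j 0 = 0) -> (norm0 u <= norm0 v)%N.
Proof.
move=> uv; apply/subset_leq_card/fintype.subsetP => j; rewrite !inE.
by apply: contra => /eqP/uv ->.
Qed.

Lemma qformZ (R : realType) (d : nat) (M : 'M[R]_d) (c : R) (v : 'cV[R]_d) :
  qform M (c *: v) = c ^+ 2 * qform M v.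
Proof.
by rewrite /qform [(c *: v)^T]linearZ/= -!scalemxAl -scalemxAr !mxE mulrA expr2.
Qed.

Lemma qformD (R : realType) (d : nat) (M : 'M[R]_d) (u v : 'cV[R]_d) :
  qform M (u + v) = qform M u + bform M u v + bform M v u + qform M v.
Proof.
by rewrite /qform /bform [(u + v)^T]linearD/= !mulmxDl !mulmxDr !mxE; ring.
Qed.

Lemma bformZl (R : realType) (d : nat) (M : 'M[R]_d) (c : R) (u v : 'cV[R]_d) :
  bform M (c *: u) v = c * bform M u v.
Proof. by rewrite /bform [(c *: u)^T]linearZ/= -!scalemxAl !mxE. Qed.

Lemma bformZr (R : realType) (d : nat) (M : 'M[R]_d) (c : R) (u v : 'cV[R]_d) :
  bform M u (c *: v) = c * bform M u v.
Proof. by rewrite /bform -scalemxAr !mxE. Qed.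

Lemma qformB (R : realType) (d : nat) (M : 'M[R]_d) (u v : 'cV[R]_d) :
  qform M (u - v) = qform M u - bform M u v - bform M v u + qform M v.
Proof. by rewrite qformD -scaleN1r qformZ bformZl bformZr; ring. Qed.

Lemma qform_sum (R : realType) (d : nat) (M : 'M[R]_d) (v : 'cV[R]_d) :
  qform M v = \sum_j \sum_k v j 0 * M j k * v k 0.
Proof.
rewrite /qform mxE exchange_big/=; apply: eq_bigr => k _.
by rewrite mxE mulr_suml; apply: eq_bigr => j _; rewrite !mxE.
Qed.

Lemma sqn_eq1_le (R : realType) (p : nat) (v : 'cV[R]_p) j :
  sqn v = 1 -> `|v j 0| <= 1.
Proof.
move=> v1; rewrite -(@ler_pXn2r _ 2)// ?nnegrE// expr1n real_normK ?num_real//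
  -v1.
by rewrite /sqn (bigD1 j)//= lerDl; apply: sumr_ge0 => k _; exact: sqr_ge0.
Qed.

Lemma qform_bounded (R : realType) (d : nat) (M : 'M[R]_d) (v : 'cV[R]_d) :
  sqn v = 1 -> `|qform M v| <= \sum_j \sum_k `|M j k|.
Proof.
move=> v1; have vj j := sqn_eq1_le j v1.
rewrite qform_sum; apply: le_trans (ler_norm_sum _ _ _) _; apply: ler_sum =>
  j _.
apply: le_trans (ler_norm_sum _ _ _) _; apply: ler_sum => k _.
rewrite !normrM -[leRHS]mulr1 -[X in X * 1]mul1r.
by apply: ler_pM => //; apply: ler_pM.
Qed.

(** Both sides are half of [a^T M b + b^T M a], which scaling [a] by 4 and [b] by [1 / 4] leaves
    unchanged. *)
Lemma qform_polarization (R : realType) (d : nat) (M : 'M[R]_d)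
    (a b : 'cV[R]_d) :
  qform M (2^-1 *: (b + a)) - qform M (2^-1 *: (b - a)) =
  (qform M (4 *: a + 4^-1 *: b) - qform M (4 *: a - 4^-1 *: b)) / 4.
Proof.
rewrite (qformZ M _ (b + a)) (qformZ M _ (b - a)) (qformD M b) (qformB M b).
rewrite (qformD M (4 *: a)) (qformB M (4 *: a)).
by rewrite !(bformZl, bformZr); field.
Qed.

(* [4 (u - w)] and [(u + w) / 4] balance the two terms in the polarization of
   [u^T M u - w^T M w] when [u - w] is short. *)
Lemma qform_diff_le (R : realType) (s d : nat) (M : 'M[R]_d) (K : R)
    (u w : 'cV[R]_d)
    (hK : forall v, (norm0 v <= s)%N -> `|qform M v| <= K * sqn v)
    (hu : (norm0 u <= s)%N) (wu : forall j, u j 0 = 0 -> w j 0 = 0) :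
  `|qform M u - qform M w| <= K * (8 * sqn (u - w) + sqn (u + w) / 32).
Proof.
pose p := 4 *: (u - w); pose q := 4^-1 *: (u + w).
have sp (v : 'cV[R]_d) : (forall j, u j 0 = 0 -> v j 0 = 0) -> (norm0 v <= s)%N.
  by move=> /norm0_le uv; exact: leq_trans uv hu.
have hpq := hK (p + q).
have hpNq := hK (p - q).
have -> : qform M u - qform M w = (qform M (p + q) - qform M (p - q)) / 4.
  by rewrite -qform_polarization; congr (qform M _ - qform M _);
    apply/matrixP => i j; rewrite !mxE; field.
have spq : sqn (p + q) + sqn (p - q) = 4 * (8 * sqn (u - w) + sqn (u + w) / 32).
  rewrite /sqn -big_split/= mulrDr !mulr_sumr mulr_suml mulr_sumr -big_split/=.
  by apply: eq_bigr => j _; rewrite !mxE; field.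
rewrite normrM [`|4^-1|]ger0_norm ?invr_ge0// ler_pdivrMr// -mulrA [_ * 4]mulrC
  -spq mulrDr.
apply: le_trans (ler_normB _ _) _; apply: lerD; [apply: hpq|apply: hpNq];
  by apply: sp => j uj; rewrite !mxE (wu _ uj) uj; ring.
Qed.

Lemma qform_mxD (R : realType) (d : nat) (A B : 'M[R]_d) (v : 'cV[R]_d) :
  qform (A + B) v = qform A v + qform B v.
Proof. by rewrite /qform mulmxDr mulmxDl mxE. Qed.

Lemma qform_mxZ (R : realType) (d : nat) (c : R) (A : 'M[R]_d) (v : 'cV[R]_d) :
  qform (c *: A) v = c * qform A v.
Proof. by rewrite /qform -scalemxAr -scalemxAl mxE. Qed.

Lemma qform_mxB (R : realType) (d : nat) (A B : 'M[R]_d) (v : 'cV[R]_d) :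
  qform (A - B) v = qform A v - qform B v.
Proof. by rewrite qform_mxD -scaleN1r qform_mxZ mulN1r. Qed.

Lemma qform_mxsum (R : realType) (d n : nat) (A : 'I_n -> 'M[R]_d) (v :
  'cV[R]_d) :
  qform (\sum_i A i) v = \sum_i qform (A i) v.
Proof. by rewrite /qform mulmx_sumr mulmx_suml summxE. Qed.

Lemma qform_le_sqn (R : realType) (s d : nat) (M : 'M[R]_d) (K : R)
    (hK : forall v, @sparse_sphere R s d v -> qform M v <= K)
    (v : 'cV[R]_d) (vs : (norm0 v <= s)%N) : qform M v <= K * sqn v.
Proof.
have [->|v0] := eqVneq v 0.
  by rewrite /qform mulmx0 mxE (eqP (_ : sqn 0 == 0)) ?mulr0// sqn_eq0.
have v_gt0 : 0 < sqn v by rewrite lt0r sqn_eq0 v0 sqn_ge0.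
have [c2 /hK] := sparse_normalize v0 vs.
by rewrite qformZ c2 mulrC ler_pdivrMr.
Qed.

(** Rounding goes towards 0: it keeps zeros, hence sparsity, and never enlarges a coordinate. *)
Lemma int_round (R : realType) (x : R) :
  exists k : int, `|k%:~R - x| <= 1 /\ `|k%:~R| <= `|x|.
Proof.
have [x0|x0] := leP 0 x.
  exists (Num.floor x); have := floor_le_tmp x; have := floorD1_gt x.
  have f0 : 0 <= (Num.floor x)%:~R :> R by rewrite ler0z floor_ge0.
  rewrite intrD => h1 h2; rewrite (ger0_norm f0) (ger0_norm x0); split => //.
  by rewrite ler_norml; apply/andP; split; lra.
exists (- Num.floor (- x)); have := floor_le_tmp (- x); have :=
  floorD1_gt (- x).
have f0 : 0 <= (Num.floor (- x))%:~R :> R by rewrite ler0z floor_ge0 oppr_ge0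
  ltW.
rewrite intrD intrN => h1 h2; rewrite normrN (ger0_norm f0) (ltr0_norm x0);
  split => //.
by rewrite ler_norml; apply/andP; split; lra.
Qed.

(* The [option] gives 0 a single code, so that [card_net] counts each lattice
   point once. *)
Definition coordinate (R : realType) (B : nat) (o : option (bool * 'I_B)) : R :=
  if o is Some (b, k) then (-1) ^+ b * k.+1%:R else 0.

Definition magnitude (B : nat) (o : option (bool * 'I_B)) : nat :=
  if o is Some (_, k) then k.+1 else 0%N.

Definition lattice_pt (R : realType) (d B : nat)
    (z : {ffun 'I_d -> option (bool * 'I_B)}) : 'cV[R]_d :=
  \col_j coordinate R (z j).

(** The size is the l1 norm, which [B] bounds as soon as it bounds the squared Euclidean norm, since
    [|k| <= k^2] for integers. The l1 norm leads to geometric series in the count. *)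
Definition net (s d B : nat) : {set {ffun 'I_d -> option (bool * 'I_B)}} :=
  [set z : {ffun 'I_d -> option (bool * 'I_B)} |
    (#|[set j | z j != None]%SET| <= s)%N && (\sum_j magnitude (z j) <=
      B)%N]%SET.

Lemma norm_coordinate (R : realType) (B : nat) (o : option (bool * 'I_B)) :
  `|coordinate R o| = (magnitude o)%:R.
Proof.
case: o => [[b k]|]/=; last by rewrite normr0.
by rewrite normrM normrX normrN1 expr1n mul1r ger0_norm.
Qed.

Lemma coordinate_eq0 (R : realType) (B : nat) (o : option (bool * 'I_B)) :
  (coordinate R o == 0) = (o == None).
Proof.
by rewrite -normr_eq0 norm_coordinate pnatr_eq0; case: o => [[]|].
Qed.

Lemma coordinate_surj (R : realType) (B : nat) (k : int) :
  (`|k|%N <= B)%N -> exists o : option (bool * 'I_B), coordinate R o = k%:~R.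
Proof.
case: k => [[|k]|k] /= kB; first by exists None.
  by exists (Some (false, Ordinal kB)); rewrite /= expr0 mul1r pmulrn.
by exists (Some (true, Ordinal kB)); rewrite /= expr1 mulN1r NegzE intrN pmulrn.
Qed.

Lemma sparse_rounding (R : realType) (s d : nat) (v : 'cV[R]_d) (r : R)
    (B : nat) (v1 : sqn v = 1) (vs : (norm0 v <= s)%N) (r0 : 0 <= r)
    (rB : r ^+ 2 <= B%:R) :
  exists2 z, z \in net s d B & [/\ forall j, v j 0 = 0 -> lattice_pt R z j 0 =
    0,
    forall j, `|r * v j 0 - lattice_pt R z j 0| <= 1 &
    forall j, `|lattice_pt R z j 0| <= r * `|v j 0| ].
Proof.
have /choice[k kP] : forall j, exists k : int,
    `|k%:~R - r * v j 0| <= 1 /\ `|k%:~R| <= `|r * v j 0|.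
  by move=> j; exact: int_round.
have sq_rv : \sum_j `|r * v j 0| ^+ 2 = r ^+ 2.
  rewrite -[RHS]mulr1 -v1 mulr_sumr; apply: eq_bigr => j _.
  by rewrite real_normK ?num_real// exprMn.
have absz_sqr j : (`|k j|%N)%:R <= `|r * v j 0| ^+ 2.
  have -> : (`|k j|%N)%:R = `|(k j)%:~R| :> R by rewrite -intr_norm.
  have [->|kj0] := eqVneq (k j) 0; first by rewrite normr0 sqr_ge0.
  have k1 : 1 <= `|(k j)%:~R| :> R.
    by rewrite -intr_norm (_ : 1 = 1%:~R)// ler_int -gtz0_ge1 normr_gt0.
  by have [_ kr] := kP j; nra.
have kB j : (`|k j|%N <= B)%N.
  rewrite -(ler_nat R); apply: le_trans (absz_sqr j) (le_trans _ rB).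
  by rewrite -sq_rv (bigD1 j)//= lerDl; apply: sumr_ge0 => i _; exact: sqr_ge0.
have /choice[f fP] : forall j, exists o : option (bool * 'I_B),
    coordinate R o = (k j)%:~R.
  by move=> j; exact: coordinate_surj.
pose z : {ffun 'I_d -> option (bool * 'I_B)} := [ffun j => f j].
have zE j : lattice_pt R z j 0 = (k j)%:~R by rewrite mxE ffunE fP.
have z0 j : v j 0 = 0 -> lattice_pt R z j 0 = 0.
  move=> vj; rewrite zE; have [_] := kP j.
  by rewrite vj mulr0 normr0 normr_le0 => /eqP.
exists z; last first.
  split=> // j; rewrite zE; case: (kP j) => kr kl; first by rewrite distrC.
  by rewrite normrM (ger0_norm r0) in kl.
rewrite inE; apply/andP; split.
  apply: leq_trans vs; apply/subset_leq_card/fintype.subsetP => j; rewrite !inE.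
  rewrite -(coordinate_eq0 R); apply: contra => /eqP/z0.
  by rewrite mxE => ->.
rewrite -(ler_nat R) natr_sum; apply: le_trans rB; rewrite -sq_rv;
  apply: ler_sum.
move=> j _; rewrite -(norm_coordinate R); apply: le_trans (absz_sqr j).
by have := zE j; rewrite mxE => ->; rewrite -intr_norm.
Qed.

Lemma norm0_lattice_pt (R : realType) (s d B : nat)
    (z : {ffun 'I_d -> option (bool * 'I_B)}) :
  z \in net s d B -> (norm0 (lattice_pt R z) <= s)%N.
Proof.
rewrite inE => /andP[zs _]; apply: leq_trans zs.
apply/subset_leq_card/fintype.subsetP => j; rewrite !inE.
by rewrite mxE coordinate_eq0.
Qed.

(** The supremum bounds itself. With [r^2 = 64 s], rounding [r v] to [z] moves at most [s]
    coordinates by at most 1, so [sqn (r v - z) <= s], while [sqn (r v + z) <= 4 * 64 s]. By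
    [qform_diff_le] the form changes by at most [(8 s + 8 s) sup], a quarter of [64 s * sup], and
    its value at [z] is at most [64 s * tau]. *)
Lemma net_bound (R : realType) (s d : nat) (M : 'M[R]_d) (tau : R)
    (s0 : (0 < s)%N) (tau0 : 0 <= tau)
    (hM : forall z, z \in net s d (64 * s) ->
      `|qform M (lattice_pt R z)| <= tau * sqn (lattice_pt R z)) :
  forall v, @sparse_sphere R s d v -> `|qform M v| <= 2 * tau.
Proof.
move=> v0 v0S.
pose S := [set `|qform M v| | v in @sparse_sphere R s d].
have supS : has_sup S.
  split; first by exists `|qform M v0|; exists v0.
  exists (\sum_j \sum_k `|M j k|) => _ [v /sparse_sphereP[v1 _] <-].
  exact: qform_bounded.
have le_sup v : @sparse_sphere R s d v -> `|qform M v| <= sup S.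
  by move=> vS; apply: sup_upper_bound => //; exists v.
suff: sup S <= 2 * tau by apply: le_trans; exact: le_sup.
have S0 : 0 <= sup S by apply: le_trans (le_sup _ v0S); exact: normr_ge0.
have hK v : (norm0 v <= s)%N -> `|qform M v| <= sup S * sqn v.
  move=> vs; rewrite ler_norml lerNl -mulN1r -qform_mxZ; apply/andP; split.
    apply: (qform_le_sqn _ vs) => u /le_sup; rewrite qform_mxZ mulN1r.
    by apply: le_trans; rewrite -normrN ler_norm.
  by apply: (qform_le_sqn _ vs) => u /le_sup; apply: le_trans; exact: ler_norm.
(* Solving this gives [4 / 3 * tau], within the announced [2 * tau]. *)
have : sup S <= sup S / 4 + tau; last by lra.
apply: ge_sup; first by case: supS.
move=> _ [v /sparse_sphereP[v1 vs] <-].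
have sR : 0 < s%:R :> R by rewrite ltr0n.
pose r : R := 8 * Num.sqrt s%:R.
have r0 : 0 <= r by rewrite mulr_ge0// sqrtr_ge0.
have r2 : r ^+ 2 = (64 * s)%:R.
  by rewrite exprMn sqr_sqrtr ?ler0n// natrM; congr (_ * _); ring.
have r2le : r ^+ 2 <= (64 * s)%:R by rewrite r2.
have [z zN [z0 zr zle]] := sparse_rounding v1 vs r0 r2le.
have rv0 j : (r *: v) j 0 = 0 -> lattice_pt R z j 0 = 0.
  rewrite mxE => /eqP; rewrite mulf_eq0 => /orP[/eqP re0|/eqP/z0]; last by [].
  
  move: r2; rewrite re0 expr0n/= => /esym/eqP;
    rewrite natrM mulf_eq0 !pnatr_eq0/=.
  by move=> /eqP s00; rewrite s00 in s0.
have h1 := qform_diff_le hK (leq_trans (norm0Z r v) vs) rv0.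
have d1 : sqn (r *: v - lattice_pt R z) <= s%:R.
  apply: (@le_trans _ _ (\sum_(j | v j 0 != 0) 1)); last first.
    by rewrite sumr_const ler_nat; move: vs; rewrite /norm0 cardsE.
  rewrite /sqn [leLHS](bigID (fun j => v j 0 != 0))/= [X in _ + X]big1 ?addr0.
    apply: ler_sum => j _; rewrite !mxE -real_normK ?num_real// expr_le1//.
    by have := zr j; rewrite mxE.
  move=> j /negPn/eqP vj; have := z0 j vj; rewrite !mxE vj => ->.
  by rewrite mulr0 subr0 expr0n.
have d2 : sqn (r *: v + lattice_pt R z) <= 256 * s%:R.
  apply: (@le_trans _ _ (\sum_j 4 * (r * v j 0) ^+ 2)).
    apply: ler_sum => j _; have := zle j; rewrite !mxE => zj.
    rewrite -real_normK ?num_real// -(@real_normK _ (r * v j 0)) ?num_real//.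
    rewrite -[4](_ : 2 ^+ 2 = _) -?exprMn; last by ring.
    rewrite ler_pXn2r ?nnegrE ?mulr_ge0// (le_trans (ler_normD _ _))//.
    by rewrite [`|r * _|]normrM (ger0_norm r0); lra.
  rewrite -mulr_sumr; under eq_bigr do rewrite exprMn.
  by rewrite -mulr_sumr -/(sqn v) v1 r2 natrM; lra.
have h2 := hM z zN.
have d3 : sqn (lattice_pt R z) <= 64 * s%:R.
  apply: (@le_trans _ _ (\sum_j (r * v j 0) ^+ 2)).
    apply: ler_sum => j _; have := zle j; rewrite !mxE => zj.
    rewrite -real_normK ?num_real// -(@real_normK _ (r * v j 0)) ?num_real//.
    by rewrite ler_pXn2r ?nnegrE// normrM (ger0_norm r0).
  under eq_bigr do rewrite exprMn.
  by rewrite -mulr_sumr -/(sqn v) v1 r2 natrM; lra.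
have h3 : sup S * (8 * sqn (r *: v - lattice_pt R z) +
    sqn (r *: v + lattice_pt R z) / 32) <= sup S * (16 * s%:R).
  by apply: ler_wpM2l => //; lra.
have h4 : tau * sqn (lattice_pt R z) <= tau * (64 * s%:R) by exact: ler_wpM2l.
have h5 : `|qform M (r *: v)| <= `|qform M (r *: v) - qform M (lattice_pt R z)|
     + `|qform M (lattice_pt R z)|.
  by rewrite -[X in `|X| <= _](subrK (qform M (lattice_pt R z))) ler_normD.
have h6 : `|qform M (r *: v)| = 64 * s%:R * `|qform M v|.
  by rewrite qformZ normrM r2 natrM ger0_norm// mulr_ge0 ?ler0n.
have := le_trans h5 (lerD (le_trans h1 h3) (le_trans h2 h4)).
rewrite h6 -(ler_pM2l sR); nra.
Qed.

Lemma sum_geometric_half (R : realType) (B : nat) :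
  \sum_(k < B) (2^-1 : R) ^+ k.+1 <= 1.
Proof.
suff -> : \sum_(k < B) (2^-1 : R) ^+ k.+1 = 1 - 2^-1 ^+ B.
  by rewrite gerBl exprn_ge0// invr_ge0.
elim: B => [|B IH]; first by rewrite big_ord0 expr0 subrr.
by rewrite big_ord_recr/= IH exprS; field.
Qed.

Lemma slog_ge (R : realType) (s d : nat) (hsd : (1 <= s <= d)%N) :
  slog R s d = s%:R + s%:R * ln (d%:R / s%:R) /\ s%:R <= slog R s d.
Proof.
have /andP[s1 sd] := hsd.
have s0 : 0 < s%:R :> R by rewrite ltr0n.
have d0 : 0 < d%:R :> R by rewrite ltr0n (leq_trans s1).
have ds : 1 <= d%:R / s%:R :> R by rewrite ler_pdivlMr// mul1r ler_nat.
have slE : slog R s d = s%:R + s%:R * ln (d%:R / s%:R).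
  rewrite /slog -mulrA lnM ?posrE ?expR_gt0 ?divr_gt0// expRK.
  by rewrite mulrDr mulr1.
by split=> //; rewrite slE lerDl mulr_ge0 ?ln_ge0// ltW.
Qed.

(* Giving a point [z] the weight [prod_j (s / d)^[z_j != 0] 2^-|z_j|], every
   point of the net weighs at least [(s / d)^s 2^-B], while the total weight is
   at most [(1 + 2 s / d)^d]. *)
Lemma card_net (R : realType) (s d B : nat) (hsd : (1 <= s <= d)%N) :
  #|net s d B|%:R <= expR (s%:R * ln (d%:R / s%:R) + 2 * s%:R + B%:R) :> R.
Proof.
have /andP[s1 sd] := hsd.
have s0 : 0 < s%:R :> R by rewrite ltr0n.
have d0 : 0 < d%:R :> R by rewrite ltr0n (leq_trans s1).
pose r : R := s%:R / d%:R.
have r0 : 0 < r by rewrite divr_gt0.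
have r1 : r <= 1 by rewrite ler_pdivrMr// mul1r ler_nat.
pose wt (u : option (bool * 'I_B)) : R :=
  (if u == None then 1 else r) * 2^-1 ^+ magnitude u.
have wt0 u : 0 <= wt u.
  by rewrite mulr_ge0 ?exprn_ge0 ?invr_ge0//; case: ifP => // _; exact: ltW.
have sum_wt : \sum_u wt u <= 1 + 2 * r.
  rewrite (bigD1 None)//= /wt/= expr0 mulr1 lerD2l.
  rewrite (reindex_omap Some id)/=; last by case.
  under eq_bigl do rewrite eqxx.
  rewrite (eq_bigr (fun p : bool * 'I_B => r * 2^-1 ^+ p.2.+1)); last by case.
  rewrite -(pair_bigA _ (fun (_ : bool) (k : 'I_B) => r * 2^-1 ^+ k.+1))/=.
  rewrite big_bool/= -mulr_sumr -mulr2n -[leLHS]mulr_natl ler_pM2l//.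
  by rewrite ger_pMr// sum_geometric_half.
have total : \sum_(z : {ffun 'I_d -> option (bool * 'I_B)}) \prod_j wt (z j) <=
    expR (2 * s%:R).
  rewrite -(bigA_distr_bigA (fun=> wt))/= prodr_const card_ord.
  have -> : 2 * s%:R = (2 * r) * d%:R by rewrite /r; field; rewrite gt_eqF.
  rewrite expRM_natr; apply: lerXn2r; rewrite ?nnegrE ?expR_ge0 ?sumr_ge0//.
  exact: le_trans sum_wt (expR_ge1Dx _).
have low z : z \in net s d B -> r ^+ s * 2^-1 ^+ B <= \prod_j wt (z j).
  rewrite inE => /andP[zs zB]; rewrite big_split/= -expr_sum; apply: ler_pM.
  - by rewrite exprn_ge0// ltW.
  - by apply: exprn_ge0; rewrite invr_ge0.
  - rewrite (bigID (fun j => z j == None))/= [X in X * _]big1 ?mul1r;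
      last first.
      by move=> j ->.
    rewrite (eq_bigr (fun=> r)); last by move=> j /negbTE ->.
    rewrite prodr_const; apply: ler_wiXn2l => //; first exact: ltW.
    by apply: leq_trans zs; apply/subset_leq_card/fintype.subsetP => j;
      rewrite inE.
  - by rewrite ler_wiXn2l ?invr_ge0// invf_le1 ?ler1n.
have h : #|net s d B|%:R * (r ^+ s * 2^-1 ^+ B) <= expR (2 * s%:R).
  apply: le_trans total; apply: (@le_trans _ _ (\sum_(z in net s d B) \prod_j
    wt (z j))).
    rewrite -[X in X%:R * _]sum1_card natr_sum mulr_suml; apply: ler_sum =>
      z zN.
    by rewrite mul1r low.
  rewrite [leRHS](bigID (fun z => z \in net s d B))/= lerDl.
  by apply: sumr_ge0 => z _; apply: prodr_ge0.
have rs : expR (s%:R * ln (d%:R / s%:R)) * r ^+ s = 1.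
  rewrite mulrC expRM_natl lnK ?posrE ?divr_gt0// -exprMn /r.
  rewrite (_ : _ / _ * (_ / _) = 1) ?expr1n//; field.
  by rewrite !gt_eqF.
have Be : 1 <= expR (B%:R) * 2^-1 ^+ B :> R.
  rewrite -[B%:R]mulr1 mulrC expRM_natl -exprMn exprn_ege1//.
  by have := expR_ge1Dx (1 : R); lra.
rewrite !expRD; set X := expR (_ * ln _) in rs *; set Y := expR (2 * _) in h *.
set Z := expR B%:R in Be *; set c := 2^-1 ^+ B in h Be.
have X0 : 0 < X by exact: expR_gt0.
have Z0 : 0 < Z by exact: expR_gt0.
apply: (@le_trans _ _ (#|net s d B|%:R * (X * r ^+ s) * (Z * c))).
  by rewrite rs mulr1 ler_peMr// ler0n.
have -> : #|net s d B|%:R * (X * r ^+ s) * (Z * c) =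
    (X * Z) * (#|net s d B|%:R * (r ^+ s * c)) by ring.
have -> : X * Y * Z = X * Z * Y by ring.
by rewrite ler_pM2l ?mulr_gt0.
Qed.

(** With [B = 64 s] the exponent is [s ln (d / s) + 66 s = slog + 65 s], and [s <= slog]. *)
Lemma card_net_slog (R : realType) (s d : nat) (hsd : (1 <= s <= d)%N) :
  #|net s d (64 * s)|%:R <= expR (66 * slog R s d) :> R.
Proof.
apply: le_trans (card_net R (64 * s) hsd) _.
have [slE sle] := slog_ge R hsd.
rewrite ler_expR natrM; lra.
Qed.

(** * Uniform deviations for one sample *)

Definition lin (R : realType) (d : nat) (v : 'cV[R]_d) (y : d.-tuple R) : R :=
  (v^T *m vec y) 0 0.

Lemma measurable_lin (R : realType) (d : nat) (v : 'cV[R]_d) :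
  measurable_fun [set: d.-tuple R] (lin v).
Proof.
rewrite (_ : lin v = fun y => \sum_j v j 0 * tnth y j); last first.
  by apply/funext => y; rewrite /lin mxE; apply: eq_bigr => j _; rewrite !mxE.
apply: measurable_sum => j; apply: measurable_funM => //.
exact: measurable_tnth.
Qed.

Lemma qform_outer (R : realType) (d : nat) (y : d.-tuple R) (v : 'cV[R]_d) :
  qform (vec y *m (vec y)^T) v = lin v y ^+ 2.
Proof.
rewrite /qform mulmxA -mulmxA mxE big_ord1 expr2; congr (_ * _).
have -> : (vec y)^T *m v = (v^T *m vec y)^T by rewrite trmx_mul trmxK.
by rewrite mxE.
Qed.

Lemma qform_sample_cov (R : realType) (n d : nat) (x : n.-tuple (d.-tuple R))
    (v : 'cV[R]_d) :
  qform (sample_cov x) v = n%:R^-1 * \sum_i lin v (tnth x i) ^+ 2.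
Proof.
by rewrite qform_mxZ qform_mxsum; under eq_bigr do rewrite qform_outer.
Qed.

Lemma qform_boot_cov (R : realType) (n d : nat) (x : n.-tuple (d.-tuple R))
    (xi : n.-tuple R) (v : 'cV[R]_d) :
  qform (boot_cov x xi) v = n%:R^-1 *
    \sum_i tnth xi i * (lin v (tnth x i) ^+ 2 - qform (sample_cov x) v).
Proof.
rewrite qform_mxZ qform_mxsum; congr (_ * _); apply: eq_bigr => i _.
by rewrite qform_mxZ qform_mxB qform_outer.
Qed.

(* [256 e] is the exponent of the moment generating functions, [66] that of the
   cardinality of the net, and [1] leaves a probability [exp (- slog)]. *)
Definition bernstein_cst (R : realType) : R := 256 * expR 1 + 67.

Lemma bernstein_cst_gt0 (R : realType) : 0 < bernstein_cst R.
Proof. by rewrite /bernstein_cst; have := expR_gt0 (1 : R); lra. Qed.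

Lemma measurable_setU_le d (T : measurableType d) (R : realType)
    (P : probability T R) (A B : set T) (a b : R) :
  measurable A -> measurable B -> (P A <= a%:E)%E -> (P B <= b%:E)%E ->
  measurable (A `|` B) /\ (P (A `|` B) <= (a + b)%:E)%E.
Proof.
move=> mA mB Pa Pb; split; first exact: measurableU.
by apply: le_trans (measureU2 P mA mB) _; rewrite EFinD leeD.
Qed.

(** * Bernstein bounds over the net, for one sample and its multipliers *)

Section one_sample.
Context d (T : measurableType d) (R : realType) (P : probability T R).
Context (n p s : nat) (x : {mfun T >-> n.-tuple (p.-tuple R)})
  (xi : {mfun T >-> n.-tuple R}) (M : 'M[R]_p) (L K theta : R).
Hypothesis indx : mutually_independent P (fun i w => tnth (x w) i).
Hypothesis indxi : mutually_independent P (fun i w => tnth (xi w) i).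
Hypothesis x_xi : independent2 P x xi.
Hypothesis nxi : forall i V, measurable V ->
  P [set w | V (tnth (xi w) i)] = normal_prob 0 1 V.
Hypothesis hsp : (1 <= s <= p)%N.
Hypothesis L0 : 0 < L.
Hypothesis theta0 : 0 < theta.
Hypothesis M0 : forall v, @sparse_sphere R s p v -> 0 < qform M v.
Hypothesis MK : forall v, @sparse_sphere R s p v -> qform M v <= K.
Hypothesis psi : forall i v, (norm0 v <= s)%N -> 0 < qform M v ->
  (\int[P]_w (expR (lin v (tnth (x w) i) ^+ 2 / (L ^+ 2 * qform M v)))%:E
     <= 2%:E)%E.
Hypothesis second : forall i v,
  (\int[P]_w (lin v (tnth (x w) i) ^+ 2)%:E = (qform M v)%:E)%E.

(** The division makes the exponential moment at most 2 and the mean [1 / L^2] for every direction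
    alike, so that one Bernstein bound serves the whole net. *)
Let W v (y : p.-tuple R) := lin v y ^+ 2 / (L ^+ 2 * qform M v).

Let mW v : measurable_fun [set: p.-tuple R] (W v).
Proof.
apply: measurable_funM => //; apply: measurable_funX; exact: measurable_lin.
Qed.

(** The origin belongs to the net but cannot be normalized; it is treated apart when [net_bound] is
    applied. *)
Let N := [set z in net s p (64 * s) | lattice_pt R z != 0]%SET.

Lemma qform_lattice_gt0 z : z \in N -> 0 < qform M (lattice_pt R z).
Proof.
rewrite inE => /andP[/(norm0_lattice_pt R) zs z0].
have [c2 /M0] := sparse_normalize z0 zs.
by rewrite qformZ c2 pmulr_rgt0// invr_gt0 lt0r sqn_eq0 z0 sqn_ge0.
Qed.

Let S (a : 'I_n -> T -> R) (z : {ffun 'I_p -> option (bool * 'I_(64 * s))}) w :=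
  \sum_i a i w * (W (lattice_pt R z) (tnth (x w) i) - (L ^+ 2)^-1).

Let mS a z : (forall i, measurable_fun [set: T] (a i)) ->
  measurable_fun [set: T] (S a z).
Proof.
move=> ma; apply: measurable_sum => i; apply: measurable_funM => //.
apply: measurable_funB => //.
exact: (measurableT_comp (mW _) (measurable_coord x i)).
Qed.

Let W0 v y : 0 < qform M v -> 0 <= W v y.
Proof. by move=> v0; rewrite /W divr_ge0 ?sqr_ge0// mulr_ge0 ?sqr_ge0// ltW.
  Qed.

Let Wmean z i : z \in N ->
  (\int[P]_w (W (lattice_pt R z) (tnth (x w) i))%:E = ((L ^+ 2)^-1)%:E)%E.
Proof.
move=> /qform_lattice_gt0 z0.
under eq_integral do rewrite /W mulrC EFinM.
rewrite ge0_integralZl_EFin//.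
- rewrite second -EFinM; congr (_%:E); field.
  by rewrite !gt_eqF.
- by move=> w _; rewrite lee_fin sqr_ge0.
- apply/measurable_EFinP; apply: measurable_funX.
  exact: (measurableT_comp (measurable_lin _) (measurable_coord x i)).
- by rewrite invr_ge0 mulr_ge0 ?sqr_ge0// ltW.
Qed.

Let psiN z i : z \in N ->
  (\int[P]_w (expR (W (lattice_pt R z) (tnth (x w) i)))%:E <= 2%:E)%E.
Proof.
move=> zN; apply: psi; last exact: qform_lattice_gt0.
by move: zN; rewrite inE => /andP[/(norm0_lattice_pt R)].
Qed.

Let sl := theta ^+ 2 * n%:R.
Let t := bernstein_cst R * theta * n%:R.

Hypothesis slE : slog R s p = sl.

(** The weights [a] may be random: constants 1 lead to the sample covariance, truncated multipliers
    to the bootstrap one. With [t = bernstein_cst * theta * n] every exponent is a multiple of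
    [sl = theta^2 n], and [66 + 256 e - bernstein_cst = - 1]. *)
Lemma tail_exponent (a : 'I_n -> T -> R) (ma : forall i, measurable_fun [set:
  T] (a i)) :
  (forall z e, z \in N -> `|e| = theta -> (\int[P]_w (expR (e * S a z w))%:E <=
      (expR (256 * expR 1 * theta ^+ 2 * n%:R))%:E)%E) ->
  (P [set w | (exists2 z, z \in N & t < `|S a z w|)%R] <= (2 * expR (-
    sl))%:E)%E.
Proof.
move=> h; apply: (le_trans (@union_chernoff _ _ _ P _ N (S a) _ theta _ t _ _
  _)).
- by move=> z; exact: mS.
- exact: ltW.
- by move=> z zN; apply: h => //; rewrite gtr0_norm.
- by move=> z zN; apply: h => //; rewrite normrN gtr0_norm.
rewrite lee_fin mulrCA ler_pM2l//.
apply: (@le_trans _ _ (expR (66 * sl) * expR (256 * expR 1 * theta ^+ 2 * n%:R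
  - theta * t))).
  apply: ler_wpM2r; first exact: expR_ge0.
  rewrite -slE; apply: le_trans (card_net_slog R hsp); rewrite ler_nat.
  by apply/subset_leq_card/fintype.subsetP => z; rewrite inE => /andP[].
by rewrite -expRD ler_expR /t /sl /bernstein_cst; lra.
Qed.

Hypothesis theta_le : theta <= 1 / 2.

Let b := (2 * theta)^-1.

Let theta_b : theta * b = 1 / 2.
Proof. by rewrite /b; field; rewrite gt_eqF. Qed.

Let b0 : 0 <= b. Proof. by rewrite invr_ge0 mulr_ge0// ltW. Qed.

Let bad1 := [set w | exists2 z, z \in N & t < `|S (fun _ _ => 1) z w|].

Let P_bad1 : (P bad1 <= (2 * expR (- sl))%:E)%E.
Proof.
apply: tail_exponent => // z e zN eth.
apply: le_trans (@mgf_weighted_sum _ _ T _ R P n x indx (W (lattice_pt R z))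
  (L ^+ 2)^-1 (mW _) _ _ _ (fun=> 1) e _) _.
- by move=> y; apply: W0; exact: qform_lattice_gt0.
- by move=> i; exact: psiN.
- by move=> i; exact: Wmean.
- by move=> i; rewrite mulr1 eth.
rewrite lee_fin mulr1 -(real_normK (num_real e)) eth.
apply: (@le_trans _ _ (\prod_(i < n) expR (256 * expR 1 * theta ^+ 2))).
  apply: ler_prod => i _; apply/andP; split.
    by rewrite addr_ge0// mulr_ge0 ?sqr_ge0// mulr_ge0// expR_ge0.
  apply: le_trans (expR_ge1Dx _); rewrite lerD2l.
  rewrite ler_wpM2r ?sqr_ge0// ler_wpM2r ?expR_ge0//.
  by rewrite ler_nat.
by rewrite -expR_sum sumr_const card_ord ler_expR mulr_natr.
Qed.

Let bad2 := [set w | exists2 z, z \in N &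
  t < `|S (fun i w => trunc b (tnth (xi w) i)) z w|].

Let mtrunc i : measurable_fun [set: T] (fun w => trunc b (tnth (xi w) i)).
Proof. exact: (measurableT_comp (measurable_trunc b) (measurable_coord xi i)).
  Qed.

Let P_bad2 : (P bad2 <= (2 * expR (- sl))%:E)%E.
Proof.
apply: tail_exponent => // z e zN eth.
have eb : `|e| * b <= 1 / 2 by rewrite eth theta_b.
rewrite -eth real_normK ?num_real//.
apply: (mgf_multiplier indx indxi x_xi nxi (mW (lattice_pt R z)) _ _ _ b0 eb).
- by move=> y; apply: W0; exact: qform_lattice_gt0.
- by move=> i; exact: psiN.
- by move=> i; exact: Wmean.
Qed.

Let mxi2 i : measurable_fun [set: T] (fun w => tnth (xi w) i ^+ 2 / 4).
Proof.
apply: measurable_funM => //; apply: measurable_funX.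
exact: measurable_coord.
Qed.

Let expxi i :
  (\int[P]_w (expR (tnth (xi w) i ^+ 2 / 4))%:E <= (expR (1 / 2))%:E)%E.
Proof.
have mE : measurable_fun [set: R] (fun u : R => (expR (u ^+ 2 / 4))%:E).
  by apply/measurable_EFinP; apply: measurableT_comp => //;
    exact: measurable_funM.
rewrite -(ge0_integral_distribution (coord xi i) mE); last first.
  by move=> u; rewrite lee_fin expR_ge0.
rewrite integral_normal_expR_sqr; last by move=> V mV; exact: nxi.
rewrite lee_fin; apply: le_trans (expR_ge1Dx _).
have := sqr_sqrtr (ler0n R 2); move: (sqrtr_ge0 (2 : R)); nra.
Qed.

(** The union bound is two-sided; for nonnegative variables the negative exponent costs nothing. *)
Let le_expR_neg (f : T -> R) (c : R) : measurable_fun [set: T] f ->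
  (forall w, 0 <= f w) -> 0 <= c ->
  (\int[P]_w (expR (- 1 * f w))%:E <= (expR c)%:E)%E.
Proof.
move=> mf f0 c0; apply: (@le_trans _ _ (\int[P]_w 1%:E)%E).
  apply: ge0_le_integral => //.
  - apply/measurable_EFinP; apply: measurableT_comp => //.
    exact: measurable_funM.
  - by move=> w _; rewrite lee_fin mulN1r -[leRHS]expR0 ler_expR oppr_le0.
rewrite integral_cst// mul1e [leLHS]probability_setT lee_fin -[leLHS]expR0.
by rewrite ler_expR.
Qed.

(** Outside this event no truncation is active. The level [b^2 / 4 = 1 / (16 theta^2)] is meant for
    [xi_i^2 / 4], whose exponential has mean [sqrt 2 <= exp (1 / 2)]. *)
Let bad3 := [set w | exists2 i, i \in [set: 'I_n]%SET &
  b ^+ 2 / 4 < `|tnth (xi w) i ^+ 2 / 4| ].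

Let P_bad3 :
  (P bad3 <= (2 * n%:R * expR (1 / 2 - (16 * theta ^+ 2)^-1))%:E)%E.
Proof.
apply: (le_trans (@union_chernoff _ _ _ P _ _
  (fun i w => tnth (xi w) i ^+ 2 / 4) _ 1 (1 / 2) _ _ _ _)) => //.
- by move=> i _; under eq_integral do rewrite mul1r; exact: expxi.
- by move=> i _; apply: le_expR_neg => // w; rewrite divr_ge0 ?sqr_ge0.
have -> : 1 * (b ^+ 2 / 4) = (16 * theta ^+ 2)^-1.
  by rewrite /b; field; rewrite gt_eqF.
by rewrite lee_fin cardsT card_ord mulrA [n%:R * 2]mulrC.
Qed.

(** This controls the mean of the multipliers, which appears when [boot_cov] is recentered at [M].
    The one-point type reduces the union bound to a single variable. *)
Let bad4 := [set w | exists2 i, i \in [set: unit]%SET &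
  3 / 2 * n%:R < `|\sum_i tnth (xi w) i ^+ 2 / 4| ].

Let P_bad4 : (P bad4 <= (2 * expR (- n%:R))%:E)%E.
Proof.
have mS4 : measurable_fun [set: T] (fun w => \sum_i tnth (xi w) i ^+ 2 / 4).
  exact: measurable_sum.
apply: (le_trans (@union_chernoff _ _ _ P _ _
  (fun _ w => \sum_i tnth (xi w) i ^+ 2 / 4) _ 1 (n%:R / 2) _ _ _ _)) => //.
- move=> _ _; pose f (i : 'I_n) (u : R) := expR (u ^+ 2 / 4).
  have mf i : measurable_fun [set: R] (f i).
    by apply: measurableT_comp => //; exact: measurable_funM.
  have f0 i u : 0 <= f i u by exact: expR_ge0.
  have ff i : (\int[P]_w (f i (coord xi i w))%:E < +oo)%E.
    exact: le_lt_trans (expxi i) (ltry _).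
  have := @integral_prod_independent _ _ T R R P _ (coord xi) indxi f mf f0 ff.
  under eq_integral do rewrite -expR_sum.
  under [X in (X <= _)%E]eq_integral do rewrite mul1r.
  move=> ->; rewrite lee_fin.
  apply: (@le_trans _ _ (\prod_(i < n) expR (1 / 2))).
    apply: ler_prod => i _; apply/andP; split.
      by apply/fine_ge0/integral_ge0 => w _; rewrite lee_fin.
    rewrite -lee_fin fineK; first exact: expxi.
    by rewrite ge0_fin_numE//; apply: integral_ge0 => w _; rewrite lee_fin.
  by rewrite -expR_sum sumr_const card_ord -[_ *+ n]mulr_natr ler_expR; lra.
- move=> _ _; apply: le_expR_neg => [//|w|]; last by rewrite divr_ge0.
  by apply: sumr_ge0 => i _; apply: divr_ge0 => //; exact: sqr_ge0.
rewrite lee_fin cardsT card_unit !mul1r.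
by rewrite ler_wpM2l// ler_expR; lra.
Qed.

Lemma one_sample_deviation : (0 < n)%N ->
  exists B : set T, [/\ measurable B,
    (P B <= (4 * expR (- sl) +
      2 * n%:R * expR (1 / 2 - (16 * theta ^+ 2)^-1) + 2 * expR (- n%:R))%:E)%E
        &
    forall w, ~ B w -> forall v, @sparse_sphere R s p v ->
      `|qform (sample_cov (x w)) v - qform M v|
         <= 2 * bernstein_cst R * L ^+ 2 * K * theta /\
      `|qform (boot_cov (x w) (xi w)) v|
         <= 12 * bernstein_cst R * L ^+ 2 * K * theta].
Proof.
move=> n0; have nR : 0 < n%:R :> R by rewrite ltr0n.
have mb1 : measurable bad1 by apply: measurable_exceed => z; exact: mS.
have mb2 : measurable bad2 by apply: measurable_exceed => z; exact: mS.
have mb3 : measurable bad3 by exact: measurable_exceed.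
have mb4 : measurable bad4.
  by apply: measurable_exceed => _; exact: measurable_sum.
have [m12 P12] := measurable_setU_le mb1 mb2 P_bad1 P_bad2.
have [m123 P123] := measurable_setU_le m12 mb3 P12 P_bad3.
have [m1234 P1234] := measurable_setU_le m123 mb4 P123 P_bad4.
exists (bad1 `|` bad2 `|` bad3 `|` bad4); split => //.
  by apply: le_trans P1234 _; rewrite lee_fin; lra.
move=> w /not_orP[/not_orP[/not_orP[nb1 nb2] nb3] nb4].
have kap0 := bernstein_cst_gt0 R.
have K0 v : @sparse_sphere R s p v -> 0 <= K.
  by move=> vS; apply: le_trans (MK vS); exact/ltW/M0.
pose tau := bernstein_cst R * L ^+ 2 * K * theta.
have tau0 v : @sparse_sphere R s p v -> 0 <= tau.
  by move=> /K0 K0'; apply: mulr_ge0 (ltW theta0); apply: mulr_ge0 K0';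
    apply: mulr_ge0 (ltW kap0) (sqr_ge0 _).
have key (a : 'I_n -> R) :
    (forall z, z \in N -> `|\sum_i a i *
       (W (lattice_pt R z) (tnth (x w) i) - (L ^+ 2)^-1)| <= t) ->
    forall v, @sparse_sphere R s p v ->
      `|n%:R^-1 * \sum_i a i * (lin v (tnth (x w) i) ^+ 2 - qform M v)|
        <= 2 * tau.
  move=> ha v vS.
  (* [A] is the weighted empirical matrix centered at the true [M]. At lattice points its form is at
     most [bernstein_cst * L^2 * theta] times [qform M], itself at most [K * sqn]; passing to the
     sphere doubles the bound. *)
  pose A := n%:R^-1 *:
    \sum_i a i *: (vec (tnth (x w) i) *m (vec (tnth (x w) i))^T - M).
  have AE u : qform A u =
      n%:R^-1 * \sum_i a i * (lin u (tnth (x w) i) ^+ 2 - qform M u).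
    rewrite qform_mxZ qform_mxsum; congr (_ * _); apply: eq_bigr => i _.
    by rewrite qform_mxZ qform_mxB qform_outer.
  rewrite -AE; apply: (net_bound _ _ _ vS).
  - by case/andP: hsp.
  - exact: tau0 vS.
  move=> z zN; have [->|z0] := eqVneq (lattice_pt R z) 0.
    by rewrite /qform mulmx0 mxE normr0 mulr_ge0 ?sqn_ge0//; exact: tau0 vS.
  have zN' : z \in N by rewrite inE zN.
  have q0 := qform_lattice_gt0 zN'.
  have qK : qform M (lattice_pt R z) <= K * sqn (lattice_pt R z).
    by apply: (qform_le_sqn MK); exact: norm0_lattice_pt zN.
  have -> : qform A (lattice_pt R z) = n%:R^-1 * (L ^+ 2 * qform M (lattice_pt
    R z)) *
      \sum_i a i * (W (lattice_pt R z) (tnth (x w) i) - (L ^+ 2)^-1).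
    rewrite AE -[RHS]mulrA; congr (_ * _); rewrite mulr_sumr; apply: eq_bigr =>
      i _.
    by rewrite /W; field; rewrite !gt_eqF.
  rewrite normrM ger0_norm; last first.
    by rewrite !mulr_ge0 ?invr_ge0 ?sqr_ge0 ?ltW.
  apply: (@le_trans _ _ (n%:R^-1 * (L ^+ 2 * qform M (lattice_pt R z)) * t)).
    by rewrite ler_wpM2l ?ha// !mulr_ge0 ?invr_ge0 ?sqr_ge0 ?ltW.
  have -> : n%:R^-1 * (L ^+ 2 * qform M (lattice_pt R z)) * t =
     (bernstein_cst R * L ^+ 2 * theta) * qform M (lattice_pt R z).
    by rewrite /t; field; rewrite gt_eqF.
  have -> : tau * sqn (lattice_pt R z) =
     (bernstein_cst R * L ^+ 2 * theta) * (K * sqn (lattice_pt R z)).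
    by rewrite /tau; ring.
  by rewrite ler_wpM2l// !mulr_ge0 ?sqr_ge0 ?ltW.
have key1 v (vS : @sparse_sphere R s p v) :
    `|qform (sample_cov (x w)) v - qform M v| <= 2 * tau.
  have h z : z \in N -> `|\sum_(i < n) 1 *
      (W (lattice_pt R z) (tnth (x w) i) - (L ^+ 2)^-1)| <= t.
    by move=> zN; rewrite leNgt; apply/negP => tz; apply: nb1; exists z.
  have := key _ h v vS; congr (`| _ | <= _).
  under eq_bigr do rewrite mul1r.
  rewrite big_split/= sumr_const card_ord -mulr_natr qform_sample_cov.
  by field; rewrite gt_eqF.
have xi_le i : `|tnth (xi w) i| <= b.
  rewrite -(@ler_pXn2r _ 2)// ?nnegrE// real_normK ?num_real// leNgt.
  apply/negP => bi; apply: nb3; exists i; first by rewrite finset.in_setT.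
  by rewrite ger0_norm ?divr_ge0 ?sqr_ge0// ltr_pM2r.
have key2 v (vS : @sparse_sphere R s p v) :
    `|n%:R^-1 * \sum_i tnth (xi w) i * (lin v (tnth (x w) i) ^+ 2 - qform M v)|
       <= 2 * tau.
  apply: key => // z zN; rewrite leNgt; apply/negP => tz; apply: nb2;
    exists z => //.
  rewrite /S; under eq_bigr do rewrite /trunc xi_le.
  by [].
(* [|u| <= 1 / 2 + u^2 / 2] gives [1 / 2 + 2 * (3 / 2)], which is below 5. *)
have sum_xi : `|n%:R^-1 * \sum_i tnth (xi w) i| <= 5.
  have h4 : \sum_i tnth (xi w) i ^+ 2 / 4 <= 3 / 2 * n%:R.
    rewrite leNgt; apply/negP => h4; apply: nb4; exists tt;
      first by rewrite finset.in_setT.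
    by rewrite ger0_norm// sumr_ge0// => i _; rewrite divr_ge0 ?sqr_ge0.
  rewrite normrM ger0_norm ?invr_ge0// mulrC ler_pdivrMr//.
  apply: le_trans (ler_norm_sum _ _ _) _.
  apply: (@le_trans _ _ (\sum_i (1 / 2 + 2 * (tnth (xi w) i ^+ 2 / 4)))).
    apply: ler_sum => i _; rewrite -(real_normK (num_real (tnth (xi w) i))).
    by have := sqr_ge0 (`|tnth (xi w) i| - 1); nra.
  rewrite big_split/= sumr_const card_ord -mulr_sumr -[_ *+ n]mulr_natr.
  lra.
move=> v vS; split; first by have := key1 v vS; rewrite /tau; lra.
rewrite qform_boot_cov.
(* Centering at the sample covariance instead of [M] costs the mean multiplier times the sample
   deviation: [2 tau + 5 * 2 tau = 12 tau]. *)
have -> : n%:R^-1 * \sum_i tnth (xi w) i *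
    (lin v (tnth (x w) i) ^+ 2 - qform (sample_cov (x w)) v) =
  n%:R^-1 * \sum_i tnth (xi w) i * (lin v (tnth (x w) i) ^+ 2 - qform M v) -
  n%:R^-1 * (\sum_i tnth (xi w) i) * (qform (sample_cov (x w)) v - qform M v).
  rewrite -mulrA -mulrBr mulr_suml -sumrB; congr (_ * _); apply: eq_bigr => i _.
  by ring.
apply: le_trans (ler_normB _ _) _; rewrite [X in _ + X]normrM.
have h5 : `|n%:R^-1 * \sum_i tnth (xi w) i| *
    `|qform (sample_cov (x w)) v - qform M v| <= 5 * (2 * tau).
  by apply: ler_pM => //; exact: key1.
by have := key2 v vS; move: h5; rewrite /tau; lra.
Qed.

End one_sample.

(** The infimum may fail to be attained, and [L1] is any real number; [|L1| + 1] is positive and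
    strictly above the infimum, so some admissible [c] lies below it. *)
Lemma psi2_norm_expR d (T : measurableType d) (R : realType)
    (P : probability T R) (Z : T -> R) (L1 : R)
    (mZ : measurable_fun [set: T] Z) (hL : (psi2_norm P Z <= L1%:E)%E) :
  (\int[P]_w (expR (Z w ^+ 2 / (`|L1| + 1) ^+ 2))%:E <= 2%:E)%E.
Proof.
have /ereal_inf_lt [_ [c [c0 hc] <-]] : (psi2_norm P Z < (`|L1| + 1)%:E)%E.
  by apply: le_lt_trans hL _; rewrite lte_fin; have := ler_norm L1; lra.
rewrite lte_fin => cL.
have mE e : measurable_fun [set: T] (fun w => expR (Z w ^+ 2 / e)).
  by apply: measurableT_comp => //; apply: measurable_funM => //;
    exact: measurable_funX.
apply: (@le_trans _ _ (\int[P]_w (expR (Z w ^+ 2 / c ^+ 2))%:E)%E).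
  apply: ge0_le_integral => //;
    [exact/measurable_EFinP|exact/measurable_EFinP|].
  move=> w _; rewrite lee_fin ler_expR ler_wpM2l ?sqr_ge0//.
  have L0 : 0 < `|L1| + 1 by rewrite ltr_wpDl.
  by rewrite lef_pV2 ?posrE ?exprn_gt0// lerXn2r ?nnegrE// ltW.
move: hc; rewrite unlock leeBlDr//.
Qed.

(** * Moments of the linear forms under the model *)

Section isotropic.
Context d (T : measurableType d) (R : realType) (P : probability T R).
Context (p : nat) (U : {mfun T >-> p.-tuple R}) (L1 : R).
Hypothesis isoU : isotropic P U.
Hypothesis psiU : (psi2_sphere P U <= L1%:E)%E.

Let mlin v : measurable_fun [set: T] (fun w => lin v (U w)).
Proof. exact: (measurableT_comp (measurable_lin v)). Qed.

Lemma expR_lin_unit v : sqn v = 1 ->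
  (\int[P]_w (expR (lin v (U w) ^+ 2 / (`|L1| + 1) ^+ 2))%:E <= 2%:E)%E.
Proof.
move=> v1; apply: (psi2_norm_expR (mlin v)).
apply: le_trans psiU; apply: ereal_sup_ubound; exists v => //.
by rewrite /sphere/= /norm2 -/(sqn v) v1 sqrtr1.
Qed.

(** Expanding [(v^T U)^2] under the integral requires integrable products of coordinates.
    [y <= L exp (y / L)] derives this from the sub-Gaussian bound in the direction
    [delta_mx j 0]. *)
Let integrable_sqr j : P.-integrable [set: T] (fun w => (tnth (U w) j ^+ 2)%:E).
Proof.
have mj : measurable_fun [set: T] (fun w =>
  tnth (U w) j) by exact: measurable_coord.
have ej : sqn (delta_mx j 0 : 'cV[R]_p) = 1.
  rewrite /sqn (bigD1 j)//= mxE !eqxx expr1n big1 ?addr0// => k kj.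
  by rewrite mxE (negbTE kj) expr0n.
have lej w : lin (delta_mx j 0 : 'cV[R]_p) (U w) = tnth (U w) j.
  rewrite /lin mxE (bigD1 j)//= big1 ?addr0; first by rewrite !mxE !eqxx mul1r.
  by move=> k kj; rewrite !mxE (negbTE kj) mul0r.
pose L : R := (`|L1| + 1) ^+ 2.
have L0 : 0 < L by rewrite exprn_gt0// ltr_wpDl.
apply/integrableP; split.
  by apply/measurable_EFinP; exact: measurable_funX.
apply: (@le_lt_trans _ _ (\int[P]_w (L%:E * (expR (lin (delta_mx j 0) (U w) ^+
  2 / L))%:E))%E).
  apply: ge0_le_integral => //.
  - by apply: measurableT_comp => //; apply/measurable_EFinP;
      exact: measurable_funX.
  - apply: emeasurable_funM => //; apply/measurable_EFinP.
    by apply: measurableT_comp => //; apply: measurable_funM => //;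
      exact: measurable_funX.
  move=> w _; rewrite gee0_abs ?lee_fin ?sqr_ge0// lej.
  rewrite -ler_pdivrMl// mulrC; apply: le_trans (expR_ge1Dx _); lra.
rewrite ge0_integralZl_EFin//; last 2 first.
- apply/measurable_EFinP.
  by apply: measurableT_comp => //; apply: measurable_funM => //;
    exact: measurable_funX.
- exact: ltW.
apply: (@le_lt_trans _ _ (L%:E * 2%:E)%E); last by rewrite -EFinM ltry.
by apply: lee_wpmul2l; [rewrite lee_fin ltW|exact: expR_lin_unit].
Qed.

Lemma second_moment_lin v :
  (\int[P]_w (lin v (U w) ^+ 2)%:E = (sqn v)%:E)%E.
Proof.
have mj j : measurable_fun [set: T] (fun w =>
  tnth (U w) j) by exact: measurable_coord.
have iUU j k : P.-integrable [set: T] (fun w =>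
  (tnth (U w) j * tnth (U w) k)%:E).
  have := integrableD measurableT (integrable_sqr j) (integrable_sqr k).
  apply: le_integrable => //; first by apply/measurable_EFinP;
    exact: measurable_funM.
  move=> w _; rewrite -EFinD !abse_EFin lee_fin [leRHS]ger0_norm ?addr_ge0
    ?sqr_ge0//.
  set a := tnth _ j; set c := tnth _ k.
  rewrite ler_norml; have := sqr_ge0 (a - c); have := sqr_ge0 (a + c).
  have := sqr_ge0 a; have := sqr_ge0 c.
  move=> *; apply/andP; split; nra.
transitivity (\int[P]_w (\sum_j \sum_k (v j 0 * v k 0)%:E * (tnth (U w) j *
  tnth (U w) k)%:E))%E.
  apply: eq_integral => w _; rewrite /lin mxE expr2 mulr_suml -sumEFin.
  apply: eq_bigr => j _; rewrite mulr_sumr -sumEFin; apply: eq_bigr => k _.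
  by rewrite !mxE -EFinM; congr (_%:E); ring.
rewrite integral_sum//; last first.
  by move=> j; apply: integrable_sum => // k _; exact: integrableZl.
rewrite /sqn -sumEFin; apply: eq_bigr => j _.
rewrite integral_sum//; last by move=> k; exact: integrableZl.
have UUE k : (\int[P]_w (tnth (U w) j * tnth (U w) k)%:E = ((1%:M : 'M[R]_p) j
  k)%:E)%E.
  rewrite -isoU unlock; apply: eq_integral => w _; congr (_%:E).
  by rewrite mxE big_ord1 !mxE.
under eq_bigr do rewrite integralZl// UUE.
rewrite (bigD1 j)//= mxE eqxx -EFinM mulr1 big1 ?adde0 ?expr2//.
by move=> k kj; rewrite mxE eq_sym (negbTE kj) mule0.
Qed.

End isotropic.

Section sample_moments.
Context d d' (T : measurableType d) (T' : measurableType d') (R : realType)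
  (P : probability T R) (P' : probability T' R).
Context (n p : nat) (x : {mfun T >-> n.-tuple (p.-tuple R)})
  (X U : {mfun T' >-> p.-tuple R}) (S M : 'M[R]_p) (L1 : R).
Hypothesis xX : copies_of P x P' X.
Hypothesis isoU : isotropic P' U.
Hypothesis psiU : (psi2_sphere P' U <= L1%:E)%E.
Hypothesis SM : is_sqrtmx S M.
Hypothesis XU : forall w, vec (X w) = S *m vec (U w).

Lemma integral_copies i (f : p.-tuple R -> \bar R) :
  measurable_fun [set: p.-tuple R] f -> (forall y, (0 <= f y)%E) ->
  (\int[P]_w f (tnth (x w) i) = \int[P']_w f (X w))%E.
Proof.
move=> mf f0.
rewrite -(ge0_integral_distribution (coord x i) mf f0).
rewrite -(ge0_integral_distribution X mf f0).
by apply: eq_measure_integral => A mA _; exact: xX.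
Qed.

Let linX v w : lin v (X w) = lin (S *m v) (U w).
Proof. by rewrite /lin XU trmx_mul SM.1.1 mulmxA. Qed.

Let sqnS v : sqn (S *m v) = qform M v.
Proof.
have -> : sqn (S *m v) = ((S *m v)^T *m (S *m v)) 0 0.
  by rewrite mxE; apply: eq_bigr => j _; rewrite [_^T _ _]mxE expr2.
by rewrite trmx_mul SM.1.1 mulmxA -[v^T *m S *m S]mulmxA SM.2.
Qed.

Lemma sample_second_moment i v :
  (\int[P]_w (lin v (tnth (x w) i) ^+ 2)%:E = (qform M v)%:E)%E.
Proof.
rewrite (@integral_copies i (fun y => (lin v y ^+ 2)%:E)).
- under eq_integral do rewrite linX.
  by rewrite (second_moment_lin isoU psiU) sqnS.
- by apply/measurable_EFinP; apply: measurable_funX; exact: measurable_lin.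
- by move=> y; rewrite lee_fin sqr_ge0.
Qed.

(** As [v^T X = (S v)^T U] and [sqn (S v) = v^T M v], dividing by [v^T M v] puts the direction [S v]
    on the unit sphere. That direction is not sparse in general, which is why the psi2 bound over
    the full sphere is called for. *)
Lemma sample_psi2 i v : 0 < qform M v ->
  (\int[P]_w (expR (lin v (tnth (x w) i) ^+ 2
    / ((`|L1| + 1) ^+ 2 * qform M v)))%:E <= 2%:E)%E.
Proof.
move=> q0; pose c := (Num.sqrt (qform M v))^-1.
have c2 : c ^+ 2 = (qform M v)^-1 by rewrite exprVn sqr_sqrtr// ltW.
rewrite (@integral_copies i
  (fun y => (expR (lin v y ^+ 2 / ((`|L1| + 1) ^+ 2 * qform M v)))%:E)).
- have u1 : sqn (c *: (S *m v)) = 1 by rewrite sqnZ c2 sqnS mulVf ?gt_eqF.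
  have := expR_lin_unit psiU u1.
  congr (_ <= _)%E; apply: eq_integral => w _; congr (expR _)%:E.
  rewrite linX /lin [(c *: _)^T]linearZ/= -scalemxAl mxE exprMn c2 [in
    RHS]invfM.
  by set a := (qform M v)^-1; set e := (_ ^+ 2)^-1; ring.
- apply/measurable_EFinP; apply: measurableT_comp => //.
  by apply: measurable_funM => //; apply: measurable_funX;
    exact: measurable_lin.
- by move=> y; rewrite lee_fin expR_ge0.
Qed.

End sample_moments.

(** * Measurability of the test *)

Lemma measurable_fun_gt d (T : measurableType d) (R : realType) (f : T -> R) :
  (forall t, measurable [set w | t < f w]) -> measurable_fun [set: T] f.
Proof.
move=> h mD; apply: (measurability _ (RGenOInfty.measurableE R)) => //.
move=> _ [_ [t ->] <-]; rewrite setTI.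
have -> : f @^-1` `]t, +oo[%classic = [set w | t < f w]; last exact: h.
by apply/seteqP; split => w /=; rewrite in_itv/= andbT.
Qed.

(** Ratios of quadratic forms ignore scale, so sparse integer vectors act as a countable dense set
    of sparse directions. *)
Definition intvec (R : realType) (p : nat) (z : {ffun 'I_p -> int}) : 'cV[R]_p
  :=
  \col_j (z j)%:~R.

Lemma qform_rounding (R : realType) (p : nat) (M : 'M[R]_p) (v u : 'cV[R]_p)
    (k : R) (k0 : 0 <= k) (v1 : forall j, `|v j 0| <= 1)
    (u1 : forall j, `|u j 0 - k * v j 0| <= 1)
    (u2 : forall j, `|u j 0| <= `|k * v j 0|) :
  `|k ^+ 2 * qform M v - qform M u| <= 2 * k * \sum_j \sum_l `|M j l|.
Proof.
rewrite -qformZ !qform_sum -sumrB mulr_sumr.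
apply: le_trans (ler_norm_sum _ _ _) _; apply: ler_sum => j _.
rewrite -sumrB mulr_sumr.
apply: le_trans (ler_norm_sum _ _ _) _; apply: ler_sum => l _.
rewrite !mxE.
have -> : k * v j 0 * M j l * (k * v l 0) - u j 0 * M j l * u l 0 =
    - ((u j 0 - k * v j 0) * (k * v l 0) + u j 0 * (u l 0 - k * v l 0)) * M j l.
  by ring.
rewrite normrM normrN ler_wpM2r//.
have kv i : `|k * v i 0| <= k by rewrite normrM ger0_norm// ler_piMr.
have uk i : `|u i 0| <= k by exact: le_trans (u2 i) (kv i).
apply: le_trans (ler_normD _ _) _; rewrite !normrM mulr_natl mulr2n.
apply: lerD; first by rewrite -[leRHS]mul1r -normrM; apply: ler_pM.
by rewrite -[leRHS]mulr1; apply: ler_pM.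
Qed.

(** The strict inequality is homogeneous of degree 2. Scaling [v] by [k] multiplies the gap [dl] by
    [k^2], whereas rounding towards 0 keeps the support and costs at most [k * c]. *)
Lemma dense_intvec (R : realType) (s p : nat) (A D : 'M[R]_p) (a t : R)
    (v : 'cV[R]_p) : 0 <= a -> 0 <= t -> @sparse_sphere R s p v ->
  t * qform D v < a * `|qform A v| ->
  exists2 z, (norm0 (intvec R z) <= s)%N &
    t * qform D (intvec R z) < a * `|qform A (intvec R z)|.
Proof.
move=> a0 t0 /sparse_sphereP[v1 vs] h.
pose m (M : 'M[R]_p) := \sum_j \sum_l `|M j l|.
have m0 M : 0 <= m M by apply: sumr_ge0 => j _; apply: sumr_ge0.
pose dl := a * `|qform A v| - t * qform D v.
have dl0 : 0 < dl by rewrite subr_gt0.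
pose c := 2 * (a * m A + t * m D).
have c0 : 0 <= c by rewrite mulr_ge0// addr_ge0// mulr_ge0.
pose k := c / dl + 1.
have k0 : 0 < k by rewrite ltr_wpDl// divr_ge0// ltW.
have /choice[r rP] : forall j, exists r : int,
    `|r%:~R - k * v j 0| <= 1 /\ `|r%:~R| <= `|k * v j 0|.
  by move=> j; exact: int_round.
pose z : {ffun 'I_p -> int} := [ffun j => r j].
have zE j : intvec R z j 0 = (r j)%:~R by rewrite mxE ffunE.
exists z.
  apply: leq_trans vs; apply: norm0_le => j vj; rewrite zE.
  have [_] := rP j.
  by rewrite vj mulr0 normr0 normr_le0 => /eqP.
have hr M : `|k ^+ 2 * qform M v - qform M (intvec R z)| <= 2 * k * m M.
  apply: qform_rounding => [|j|j|j]; first exact: ltW.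
  - exact: sqn_eq1_le.
  - by rewrite zE; case: (rP j).
  - by rewrite zE; case: (rP j).
have hA : k ^+ 2 * `|qform A v| - 2 * k * m A <= `|qform A (intvec R z)|.
  have := ler_normD (k ^+ 2 * qform A v - qform A (intvec R z)) (qform A
    (intvec R z)).
  rewrite subrK normrM ger0_norm ?sqr_ge0//; have := hr A; lra.
have hD : qform D (intvec R z) <= k ^+ 2 * qform D v + 2 * k * m D.
  by have := hr D; rewrite ler_norml => /andP[]; lra.
have := ler_wpM2l a0 hA; have := ler_wpM2l t0 hD.
have kdl : k * dl = c + dl by rewrite /k mulrDl divfK ?gt_eqF// mul1r.
have : 0 < k * (k * dl - c) by rewrite kdl addrAC subrr add0r mulr_gt0.
rewrite /dl /c; lra.
Qed.

(** Domination of the numerator by the denominator bounds the ratios; on an unbounded set [sup]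
    would take its default value 0. *)
Lemma has_sup_ratio (R : realType) (s p : nat) (A D : 'M[R]_p) (a b : R)
    (D0 : forall v, 0 <= qform D v)
    (AD : forall v, `|qform A v| <= b * qform D v)
    (sphere0 : exists v, @sparse_sphere R s p v) :
  has_sup [set `|a * (qform A v / qform D v)| | v in @sparse_sphere R s p].
Proof.
have [v0 v0S] := sphere0; split.
  by exists `|a * (qform A v0 / qform D v0)|; exists v0.
exists (`|a| * `|b|) => _ [v vS <-].
rewrite normrM ler_wpM2l// normrM normfV (ger0_norm (D0 v)).
have [->|Dv] := eqVneq (qform D v) 0; first by rewrite invr0 mulr0.
have Dv0 : 0 < qform D v by rewrite lt0r Dv D0.
rewrite ler_pdivrMr//; apply: le_trans (AD v) _.
by rewrite ler_wpM2r// ler_norm.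
Qed.

Lemma measurable_sup_ratio d (T : measurableType d) (R : realType) (s p : nat)
    (A D : T -> 'M[R]_p) (a : R) (b : T -> R) (a0 : 0 <= a)
    (mA : forall v, measurable_fun [set: T] (fun w => qform (A w) v))
    (mD : forall v, measurable_fun [set: T] (fun w => qform (D w) v))
    (D0 : forall w v, 0 <= qform (D w) v)
    (AD : forall w v, `|qform (A w) v| <= b w * qform (D w) v)
    (sphere0 : exists v, @sparse_sphere R s p v) :
  measurable_fun [set: T] (fun w =>
    sup [set `|a * (qform (A w) v / qform (D w) v)| | v in @sparse_sphere R s
      p]).
Proof.
apply: measurable_fun_gt => t.
have hs w : has_sup [set `|a * (qform (A w) v / qform (D w) v)| | v in
  @sparse_sphere R s p].
  exact: (has_sup_ratio a (D0 w) (AD w) sphere0).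
have le_sup w v : @sparse_sphere R s p v ->
    `|a * (qform (A w) v / qform (D w) v)| <=
    sup [set `|a * (qform (A w) v / qform (D w) v)| | v in @sparse_sphere R s
      p].
  by move=> vS; apply: sup_upper_bound => //; exists v.
(* Negative levels are exceeded everywhere, the ratios being absolute values; for [t >= 0] the
   denominator can be cleared even where it vanishes, since the numerator then vanishes too. *)
have [t0|t0] := ltP t 0.
  rewrite (_ : [set w | _] = [set: T])//; apply/seteqP; split => w //= _.
  have [v0 v0S] := sphere0; apply: (lt_le_trans t0).
  by apply: le_trans (le_sup w v0 v0S); exact: normr_ge0.
have gtE w v : (t < `|a * (qform (A w) v / qform (D w) v)|) =
    (t * qform (D w) v < a * `|qform (A w) v|).
  rewrite normrM (ger0_norm a0) normrM normfV (ger0_norm (D0 w v)).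
  have [Dv|Dv] := eqVneq (qform (D w) v) 0.
    have := AD w v; rewrite Dv mulr0 normr_le0 => /eqP ->.
    by rewrite normr0 mul0r !mulr0 ltNge t0 ltxx.
  have Dv0 : 0 < qform (D w) v by rewrite lt0r Dv D0.
  by rewrite mulrA ltr_pdivlMr.
pose Z (z : {ffun 'I_p -> int}) := [set w | (norm0 (intvec R z) <= s)%N &&
  (t * qform (D w) (intvec R z) < a * `|qform (A w) (intvec R z)|)].
have -> : [set w | t < sup [set `|a * (qform (A w) v / qform (D w) v)| |
    v in @sparse_sphere R s p]] = \bigcup_(z in [set: {ffun 'I_p -> int}]) Z z.
  apply/seteqP; split => w /=.
    move=> /(sup_gt (hs w).1)[_ [v vS <-]]; rewrite gtE => h.
    by have [z zs hz] := dense_intvec a0 t0 vS h; exists z => //;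
      rewrite /Z/= zs.
  move=> [z _ /andP[zs hz]].
  have z0 : intvec R z != 0.
    apply/negP => /eqP z0; move: hz.
    by rewrite z0 /qform !mulmx0 !mxE normr0 !mulr0 ltxx.
  have zq : 0 < sqn (intvec R z) by rewrite lt0r sqn_eq0 z0 sqn_ge0.
  have [c2 cS] := sparse_normalize z0 zs.
  apply: lt_le_trans (le_sup w _ cS).
  rewrite gtE !qformZ c2 normrM ger0_norm ?invr_ge0 ?sqn_ge0//.
  by rewrite mulrCA [ltRHS]mulrCA ltr_pM2l ?invr_gt0.
apply: countable_bigcupT_measurable => // z.
rewrite /Z; case: leqP => _ /=; last first.
  by rewrite (_ : [set w | _] = set0)//; apply/seteqP; split.
rewrite (_ : [set w | _] = (fun w => a * `|qform (A w) (intvec R z)| -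
    t * qform (D w) (intvec R z)) @^-1` `]0, +oo[%classic); last first.
  by apply/seteqP; split => w /=; rewrite in_itv/= andbT subr_gt0.
rewrite -[X in measurable X]setTI.
have mf : measurable_fun [set: T] (fun w => a * `|qform (A w) (intvec R z)| -
    t * qform (D w) (intvec R z)).
  apply: measurable_funB; apply: measurable_funM => //.
  exact: measurableT_comp.
by apply: mf.
Qed.

(** [0 <= t] covers the default value 0 of [inf] on sets without infimum. *)
Lemma quantile_le (R : realType) (mu : set R -> \bar R) (p t : R) : 0 <= t ->
  (p%:E <= mu [set u | (u <= t)%R])%E -> quantile mu p <= t.
Proof.
move=> t0 h; rewrite /quantile; set S := [set t | _].
have [hi|hi] := pselect (has_inf S).
  by apply: ge_inf => //; case: hi.
by rewrite inf_out.
Qed.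

(** The quantile is below [t] exactly when the distribution function reaches [p] at some rational
    below [t]: a countable union of measurable events. This is valid on [G], where the set defining
    the quantile is nonempty and bounded below; elsewhere the quantile is the default value 0. *)
Lemma measurable_quantile d d1 (T : measurableType d) (E : measurableType d1)
    (R : realType) (kappa : R.-pker E ~> R) (D : T -> E) (p : R)
    (mD : measurable_fun [set: T] D) :
  measurable_fun [set: T] (fun w => quantile (kappa (D w)) p).
Proof.
pose F w (t : R) := kappa (D w) [set u | (u <= t)%R].
have mle (t : R) : measurable [set u : R | (u <= t)%R].
  have -> : [set u : R | (u <= t)%R] = `]-oo, t]%classic.
    by apply/seteqP; split => u /=; rewrite in_itv.
  exact: measurable_itv.
have Fnd w t t' : t <= t' -> (F w t <= F w t')%E.
  move=> tt'; apply: le_measure; rewrite ?inE; [exact: mle|exact: mle|].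
  by move=> u /= ut; exact: le_trans tt'.
have mF t : measurable_fun [set: T] (F ^~ t).
  exact: (measurableT_comp (measurable_kernel kappa _ (mle t)) mD).
have mS t : measurable [set w | (p%:E <= F w t)%E].
  by rewrite -[X in measurable X]setTI; exact: emeasurable_fun_c_infty.
pose G := (\bigcup_(k : nat) [set w | (p%:E <= F w k%:R%R)%E]) `&`
  (\bigcup_(k : nat) ~` [set w | (p%:E <= F w (- k%:R)%R)%E]).
have mG : measurable G.
  apply: measurableI; apply: bigcupT_measurable => k; first exact: mS.
  exact: measurableC.
pose S w := [set t : R | (p%:E <= F w t)%E].
have GP w : G w <-> has_inf (S w).
  split=> [[[k _ /= hk] [l _ /= hl]]|[[u Su] [l lS]]].
    split; first by exists k%:R.
    exists (- l%:R) => t /= St; rewrite leNgt; apply/negP => tl; apply: hl.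
    by apply: le_trans St _; apply: Fnd; exact: ltW.
  split.
    exists (Num.truncn `|u|).+1 => //=; apply: le_trans Su _; apply: Fnd.
    by apply: le_trans (ler_norm _) _; exact/ltW/truncnS_gt.
  exists (Num.truncn `|l|).+1 => //= Sl; have := lS _ Sl.
  have : `|l| < (Num.truncn `|l|).+1%:R by exact: truncnS_gt.
  by rewrite ltr_norml => /andP[]; lra.
pose V (t : R) := G `&` \bigcup_(r : rat)
  (if ratr r < t then [set w | (p%:E <= F w (ratr r))%E] else set0).
have mV t : measurable (V t).
  apply: measurableI => //; apply: countable_bigcupT_measurable => // r.
  by case: ifP => _; [exact: mS|exact: measurable0].
have VE t w : G w -> (quantile (kappa (D w)) p < t) <-> V t w.
  move=> Gw; have hi := (GP w).1 Gw; split=> [qt|[_ [r _]]].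
    split => //; have [u Su ut] := inf_lt hi.1 qt.
    have [q] := rat_in_itvoo ut; rewrite in_itv/= => /andP[uq qt'].
    by exists q => //; rewrite qt' /=; apply: le_trans Su _; exact/Fnd/ltW.
  case: ifP => // rt /= Sr; apply: le_lt_trans rt.
  by apply: ge_inf => //; case: hi.
have qE w : ~ G w -> quantile (kappa (D w)) p = 0.
  by move=> nG; rewrite /quantile inf_out// => hi; apply: nG; exact/GP.
(* [measurable_fun_gt] asks for events [t < f], while the infimum describes [quantile < t]: hence
   the change of sign. *)
rewrite (_ : (fun w => _) = \- (fun w => - quantile (kappa (D w)) p));
  last first.
  by apply/funext => w /=; rewrite opprK.
apply: measurableT_comp => //; apply: measurable_fun_gt => t.
rewrite (_ : [set w | _] = V (- t) `|` (if 0 < - t then ~` G else set0)).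
  by apply: measurableU => //; case: ifP => _;
    [exact: measurableC|exact: measurable0].
apply/seteqP; split => w /=.
  rewrite ltrNr; have [Gw|nG] := pselect (G w); first by move/(VE _ _ Gw); left.
  by rewrite (qE _ nG) => h; right; rewrite h.
move=> H; rewrite ltrNr; case: H => [Vw|]; first by apply/(VE _ _ Vw.1).
by case: ifP => // h nG; rewrite (qE _ nG).
Qed.

Lemma sparse_sphere_nonempty (R : realType) (s p : nat) (hsp : (1 <= s <= p)%N)
  :
  exists v, @sparse_sphere R s p v.
Proof.
case: p hsp => [|p]; first by case: s.
case/andP => s1 _; exists (delta_mx 0 0); apply/sparse_sphereP; split.
  rewrite /sqn (bigD1 0)//= mxE !eqxx expr1n big1 ?addr0// => k k0.
  by rewrite mxE (negbTE k0) expr0n.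
apply: leq_trans s1; apply: (@leq_trans #|[set (0 : 'I_p.+1)]%SET|);
  last by rewrite cards1.
apply/subset_leq_card/fintype.subsetP => j; rewrite !inE mxE.
by apply: contraR => /negbTE ->; rewrite eqxx.
Qed.

(** * The two statistics: domination by the denominator and measurability *)

Section statistics.
Context (R : realType) (n m s p : nat).
Hypothesis n0 : (0 < n)%N.
Hypothesis m0 : (0 < m)%N.
Hypothesis hsp : (1 <= s <= p)%N.

Let nR : 0 < n%:R :> R. Proof. by rewrite ltr0n. Qed.
Let mR : 0 < m%:R :> R. Proof. by rewrite ltr0n. Qed.

Definition pooled_mx (M1 M2 : 'M[R]_p) := n%:R^-1 *: M1 + m%:R^-1 *: M2.

Lemma qform_pooled (M1 M2 : 'M[R]_p) v : qform (pooled_mx M1 M2) v =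
  n%:R^-1 * qform M1 v + m%:R^-1 * qform M2 v.
Proof. by rewrite qform_mxD !qform_mxZ. Qed.

Lemma sample_cov_ge0 k (x : k.-tuple (p.-tuple R)) v : 0 <= qform (sample_cov
  x) v.
Proof.
rewrite qform_sample_cov mulr_ge0 ?invr_ge0//.
by apply: sumr_ge0 => i _; exact: sqr_ge0.
Qed.

Implicit Types (x : n.-tuple (p.-tuple R)) (y : m.-tuple (p.-tuple R)).

Lemma pooled_ge0 x y v : 0 <= qform (pooled_mx (sample_cov x) (sample_cov y)) v.
Proof.
by rewrite qform_pooled addr_ge0// mulr_ge0 ?invr_ge0// sample_cov_ge0.
Qed.

Let pooled_lb x y v :
  qform (sample_cov x) v + qform (sample_cov y) v <=
  (n + m)%:R * qform (pooled_mx (sample_cov x) (sample_cov y)) v.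
Proof.
rewrite qform_pooled natrD.
have hx := sample_cov_ge0 x v; have hy := sample_cov_ge0 y v.
have -> : (n%:R + m%:R) * (n%:R^-1 * qform (sample_cov x) v +
    m%:R^-1 * qform (sample_cov y) v) =
  qform (sample_cov x) v + qform (sample_cov y) v +
  (m%:R / n%:R * qform (sample_cov x) v + n%:R / m%:R * qform (sample_cov y) v).
  by field; rewrite !gt_eqF.
by rewrite lerDl addr_ge0// mulr_ge0// divr_ge0// ltW.
Qed.

Lemma Q_numerator_le x y v : `|qform (sample_cov x - sample_cov y) v| <=
  (n + m)%:R * qform (pooled_mx (sample_cov x) (sample_cov y)) v.
Proof.
apply: le_trans (pooled_lb x y v); rewrite qform_mxB.
apply: le_trans (ler_normB _ _) _.
by rewrite !ger0_norm// sample_cov_ge0.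
Qed.

(** A single square is at most the sum of all of them, that is [k] times the sample form, and the
    centering term obeys the same bound; hence the factor 2. *)
Let boot_le k (k0 : (0 < k)%N) (x : k.-tuple (p.-tuple R)) (xi : k.-tuple R) v :
  `|qform (boot_cov x xi) v| <=
  (2 * \sum_i `|tnth xi i|) * qform (sample_cov x) v.
Proof.
have kR : 0 < k%:R :> R by rewrite ltr0n.
rewrite qform_boot_cov normrM ger0_norm ?invr_ge0//.
have -> : 2 * (\sum_i `|tnth xi i|) * qform (sample_cov x) v =
    k%:R^-1 * \sum_i `|tnth xi i| * (2 * k%:R * qform (sample_cov x) v).
  rewrite -mulr_suml; field; rewrite gt_eqF//.
rewrite ler_wpM2l ?invr_ge0//.
apply: le_trans (ler_norm_sum _ _ _) _; apply: ler_sum => i _.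
rewrite normrM ler_wpM2l//; apply: le_trans (ler_normB _ _) _.
have q0 := sample_cov_ge0 x v.
rewrite [`|qform _ _|]ger0_norm// ger0_norm ?sqr_ge0//.
have h1 : lin v (tnth x i) ^+ 2 <= k%:R * qform (sample_cov x) v.
  rewrite qform_sample_cov mulrA divff ?gt_eqF// mul1r (bigD1 i)//= lerDl.
  by apply: sumr_ge0 => j _; exact: sqr_ge0.
have h2 : qform (sample_cov x) v <= k%:R * qform (sample_cov x) v.
  by rewrite ler_peMl// ler1n.
by lra.
Qed.

Let boot_bound (xi : n.-tuple R) (eta : m.-tuple R) : R :=
  (2 * (\sum_i `|tnth xi i| + \sum_i `|tnth eta i|)) * (n + m)%:R.

Lemma B_numerator_le x y xi eta v :
  `|qform (boot_cov x xi - boot_cov y eta) v| <=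
  boot_bound xi eta * qform (pooled_mx (sample_cov x) (sample_cov y)) v.
Proof.
rewrite /boot_bound; set q := qform (pooled_mx _ _) _;
  rewrite -[leRHS]mulrA {}/q.
apply: (@le_trans _ _ (2 * (\sum_i `|tnth xi i| + \sum_i `|tnth eta i|) *
    (qform (sample_cov x) v + qform (sample_cov y) v))); last first.
  apply: ler_wpM2l (pooled_lb x y v).
  by apply: mulr_ge0 => //; apply: addr_ge0; exact: sumr_ge0.
rewrite qform_mxB; apply: le_trans (ler_normB _ _) _.
have h1 := boot_le n0 x xi v; have h2 := boot_le m0 y eta v.
have a0 : 0 <= \sum_i `|tnth xi i| by exact: sumr_ge0.
have b0 : 0 <= \sum_i `|tnth eta i| by exact: sumr_ge0.
have hx := sample_cov_ge0 x v; have hy := sample_cov_ge0 y v.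
apply: le_trans (lerD h1 h2) _; nra.
Qed.

Lemma has_sup_Q x y : has_sup [set `|scaled_ratio n m (sample_cov x -
  sample_cov y)
  (sample_cov x) (sample_cov y) v| | v in @sparse_sphere R s p].
Proof.
exact: has_sup_ratio (pooled_ge0 x y) (Q_numerator_le x y)
  (sparse_sphere_nonempty R hsp).
Qed.

Context d (T : measurableType d) (x : {mfun T >-> n.-tuple (p.-tuple R)})
  (y : {mfun T >-> m.-tuple (p.-tuple R)}) (xi : {mfun T >-> n.-tuple R})
  (eta : {mfun T >-> m.-tuple R}).

Lemma measurable_sample_cov k (z : {mfun T >-> k.-tuple (p.-tuple R)}) v :
  measurable_fun [set: T] (fun w => qform (sample_cov (z w)) v).
Proof.
under eq_fun do rewrite qform_sample_cov.
apply: measurable_funM => //; apply: measurable_sum => i.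
apply: measurable_funX.
exact: (measurableT_comp (measurable_lin v) (measurable_coord z i)).
Qed.

Lemma measurable_boot_cov k (z : {mfun T >-> k.-tuple (p.-tuple R)})
    (zeta : {mfun T >-> k.-tuple R}) v :
  measurable_fun [set: T] (fun w => qform (boot_cov (z w) (zeta w)) v).
Proof.
under eq_fun do rewrite qform_boot_cov.
apply: measurable_funM => //; apply: measurable_sum => i.
apply: measurable_funM; first exact: measurable_coord.
apply: measurable_funB; last exact: measurable_sample_cov.
apply: measurable_funX.
exact: (measurableT_comp (measurable_lin v) (measurable_coord z i)).
Qed.

Let measurable_pooled v : measurable_fun [set: T]
  (fun w => qform (pooled_mx (sample_cov (x w)) (sample_cov (y w))) v).
Proof.
under eq_fun do rewrite qform_pooled.
by apply: measurable_funD; apply: measurable_funM => //;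
  exact: measurable_sample_cov.
Qed.

Lemma measurable_Q_max : measurable_fun [set: T] (fun w => Q_max s (x w) (y w)).
Proof.
apply: (measurable_sup_ratio (sqrtr_ge0 _) _ measurable_pooled
  (fun w => pooled_ge0 (x w) (y w)) (fun w => Q_numerator_le (x w) (y w))
  (sparse_sphere_nonempty R hsp)) => v.
under eq_fun do rewrite qform_mxB.
by apply: measurable_funB; exact: measurable_sample_cov.
Qed.

Lemma measurable_B_max :
  measurable_fun [set: T] (fun w => B_max s (x w) (y w) (xi w) (eta w)).
Proof.
apply: (measurable_sup_ratio (sqrtr_ge0 _) _ measurable_pooled
  (fun w => pooled_ge0 (x w) (y w))
  (fun w => B_numerator_le (x w) (y w) (xi w) (eta w))
  (sparse_sphere_nonempty R hsp)) => v.
under eq_fun do rewrite qform_mxB.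
by apply: measurable_funB; exact: measurable_boot_cov.
Qed.

End statistics.

(** * Power of the test *)

Section ratios.
Context (R : realType) (n m p : nat) (S1 S2 A1 A2 N1 N2 : 'M[R]_p)
  (v : 'cV[R]_p) (e1 e2 beta : R).
Hypothesis n0 : (0 < n)%N.
Hypothesis m0 : (0 < m)%N.
Let D := qform (n%:R^-1 *: S1 + m%:R^-1 *: S2) v.
Let Dh := qform (n%:R^-1 *: A1 + m%:R^-1 *: A2) v.
Let rho : R := Num.sqrt ((n + m)%:R / (n * m)%:R).
Hypothesis S1_gt0 : 0 < qform S1 v.
Hypothesis S2_gt0 : 0 < qform S2 v.
Hypothesis A1_near : `|qform A1 v - qform S1 v| <= e1 * qform S1 v.
Hypothesis A2_near : `|qform A2 v - qform S2 v| <= e2 * qform S2 v.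
Hypothesis e1_le : e1 <= 1 / 2.
Hypothesis e2_le : e2 <= 1 / 2.
Hypothesis beta_ge : rho * (e1 * qform S1 v + e2 * qform S2 v) <= beta * D.

Let nV : 0 < n%:R^-1 :> R. Proof. by rewrite invr_gt0 ltr0n. Qed.
Let mV : 0 < m%:R^-1 :> R. Proof. by rewrite invr_gt0 ltr0n. Qed.

Let DE : D = n%:R^-1 * qform S1 v + m%:R^-1 * qform S2 v.
Proof. by rewrite /D qform_mxD !qform_mxZ. Qed.

Let DhE : Dh = n%:R^-1 * qform A1 v + m%:R^-1 * qform A2 v.
Proof. by rewrite /Dh qform_mxD !qform_mxZ. Qed.

Let D_gt0 : 0 < D.
Proof. by rewrite DE addr_gt0// mulr_gt0. Qed.

Let near_half (S A e : R) : 0 < S -> `|A - S| <= e * S -> e <= 1 / 2 ->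
  S / 2 <= A <= 3 / 2 * S.
Proof. by move=> S0; rewrite ler_norml => /andP[? ?] ?; apply/andP; split;
  nra. Qed.

Let Dh_bounds : D / 2 <= Dh <= 3 / 2 * D.
Proof.
have /andP[a1 a2] := near_half S1_gt0 A1_near e1_le.
have /andP[b1 b2] := near_half S2_gt0 A2_near e2_le.
rewrite DE DhE.
have := ler_wpM2l (ltW nV) a1; have := ler_wpM2l (ltW nV) a2.
have := ler_wpM2l (ltW mV) b1; have := ler_wpM2l (ltW mV) b2.
by move=> *; apply/andP; split; lra.
Qed.

Let Dh_gt0 : 0 < Dh.
Proof. by case/andP: Dh_bounds => h _; apply: lt_le_trans h;
  rewrite divr_gt0. Qed.

Let rho_ge0 : 0 <= rho. Proof. exact: sqrtr_ge0. Qed.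

(** The sample denominator is at least [D / 2], so the 6 of the hypotheses becomes 12. *)
Lemma boot_ratio_le : `|qform N1 v| <= 6 * e1 * qform S1 v ->
  `|qform N2 v| <= 6 * e2 * qform S2 v ->
  `|scaled_ratio n m (N1 - N2) A1 A2 v| <= 12 * beta.
Proof.
move=> h1 h2; rewrite /scaled_ratio -/rho -/Dh mulrA normrM.
rewrite normfV (gtr0_norm Dh_gt0) ler_pdivrMr// normrM (ger0_norm rho_ge0)
  qform_mxB.
apply: (@le_trans _ _ (rho * (6 * (e1 * qform S1 v + e2 * qform S2 v)))).
  by apply: ler_wpM2l => //; apply: le_trans (ler_normB _ _) _; lra.
have beta0 : 0 <= beta.
  rewrite -(pmulr_lge0 _ D_gt0); apply: le_trans beta_ge; apply: mulr_ge0 => //.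
  apply: addr_ge0; first exact: le_trans (normr_ge0 _) A1_near.
  exact: le_trans (normr_ge0 _) A2_near.
case/andP: Dh_bounds => h _.
by have := ler_wpM2l beta0 h; move: beta_ge; lra.
Qed.

(** Passing to the samples lowers the scaled numerator by at most [beta * D] and raises the
    denominator to at most [3 / 2 * D]; [beta <= gamma] gives the sign that the second bound
    requires. *)
Lemma sample_ratio_ge (gamma : R) :
  gamma <= rho * `|qform (S1 - S2) v / D| -> beta <= gamma ->
  2 / 3 * (gamma - beta) <= `|scaled_ratio n m (A1 - A2) A1 A2 v|.
Proof.
rewrite normrM normfV (gtr0_norm D_gt0) mulrA ler_pdivlMr// => hg bg.
rewrite /scaled_ratio -/rho -/Dh mulrA normrM.
rewrite normfV (gtr0_norm Dh_gt0) ler_pdivlMr// normrM (ger0_norm rho_ge0).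
have hdiff : `|qform (S1 - S2) v| <=
    `|qform (A1 - A2) v| + (e1 * qform S1 v + e2 * qform S2 v).
  have -> : qform (S1 - S2) v = qform (A1 - A2) v -
      ((qform A1 v - qform S1 v) - (qform A2 v - qform S2 v)).
    by rewrite !qform_mxB; ring.
  apply: le_trans (ler_normB _ _) _; rewrite lerD2l.
  apply: le_trans (ler_normB _ _) _; exact: lerD.
have h1 := ler_wpM2l rho_ge0 hdiff.
case/andP: Dh_bounds => _ hD.
have gb0 : 0 <= gamma - beta by rewrite subr_ge0.
have := ler_wpM2l gb0 hD.
by move: h1 hg beta_ge; rewrite mulrDr; lra.
Qed.

End ratios.

Lemma lambda_bounds (R : realType) (s p : nat) (M : 'M[R]_p) (v : 'cV[R]_p) :
  @sparse_sphere R s p v -> lambda_min s M <= qform M v <= lambda_max s M.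
Proof.
move=> vS; apply/andP; split.
  apply: ge_inf; last by exists v.
  exists (- \sum_j \sum_k `|M j k|) => _ [u /sparse_sphereP[u1 _] <-].
  by have := qform_bounded M u1; rewrite ler_norml => /andP[].
apply: sup_upper_bound; last by exists v.
split; first by exists (qform M v); exists v.
exists (\sum_j \sum_k `|M j k|) => _ [u /sparse_sphereP[u1 _] <-].
exact: le_trans (ler_norm _) (qform_bounded M u1).
Qed.

Section marginals.
Context d d1 d2 (T : measurableType d) (E : measurableType d1)
  (F : measurableType d2) (R : realType) (P : probability T R) (n m : nat).

Lemma mutually_independent_inl (x : T -> n.-tuple E) (y : T -> m.-tuple E) :
  mutually_independent P (pooled x y) ->
  mutually_independent P (fun i w => tnth (x w) i).
Proof.
move=> h A mA.
pose A' (k : 'I_n + 'I_m) := if k is inl i then A i else [set: E].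
have mA' k : measurable (A' k) by case: k => [i|j]/=.
have := h A' mA'; rewrite big_sumType/= [X in (_ * X)%E]big1 ?mule1; last first.
  by move=> j _; rewrite preimage_setT; exact: probability_setT.
move=> <-; congr (P _); apply/seteqP; split => w /= hw.
  by case=> [i|j] _ //; exact: hw.
by move=> i _; exact: (hw (inl i)).
Qed.

Lemma mutually_independent_inr (x : T -> n.-tuple E) (y : T -> m.-tuple E) :
  mutually_independent P (pooled x y) ->
  mutually_independent P (fun i w => tnth (y w) i).
Proof.
move=> h A mA.
pose A' (k : 'I_n + 'I_m) := if k is inr i then A i else [set: E].
have mA' k : measurable (A' k) by case: k => [i|j]/=.
have := h A' mA'; rewrite big_sumType/= [X in (X * _)%E]big1 ?mul1e; last first.
  by move=> j _; rewrite preimage_setT; exact: probability_setT.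
move=> <-; congr (P _); apply/seteqP; split => w /= hw.
  by case=> [i|j] _ //; exact: hw.
by move=> i _; exact: (hw (inr i)).
Qed.

End marginals.

Lemma independent2_fst d d1 d2 d3 d4 (T : measurableType d)
    (E1 : measurableType d1) (E2 : measurableType d2) (E3 : measurableType d3)
    (E4 : measurableType d4) (R : realType) (P : probability T R)
    (x : T -> E1) (y : T -> E2) (xi : T -> E3) (eta : T -> E4) :
  independent2 P (fun w => (x w, y w)) (fun w => (xi w, eta w)) ->
  independent2 P x xi.
Proof.
move=> h A B mA mB.
have := h (A `*` setT) (B `*` setT) (measurableX mA measurableT)
  (measurableX mB measurableT).
have -> : (fun w => (x w, y w)) @^-1` (A `*` setT) = x @^-1` A.
  by apply/seteqP; split => w //= [].
have -> : (fun w => (xi w, eta w)) @^-1` (B `*` setT) = xi @^-1` B.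
  by apply/seteqP; split => w //= [].
by [].
Qed.

Lemma independent2_snd d d1 d2 d3 d4 (T : measurableType d)
    (E1 : measurableType d1) (E2 : measurableType d2) (E3 : measurableType d3)
    (E4 : measurableType d4) (R : realType) (P : probability T R)
    (x : T -> E1) (y : T -> E2) (xi : T -> E3) (eta : T -> E4) :
  independent2 P (fun w => (x w, y w)) (fun w => (xi w, eta w)) ->
  independent2 P y eta.
Proof.
move=> h A B mA mB.
have := h (setT `*` A) (setT `*` B) (measurableX measurableT mA)
  (measurableX measurableT mB).
have -> : (fun w => (x w, y w)) @^-1` (setT `*` A) = y @^-1` A.
  by apply/seteqP; split => w //= [].
have -> : (fun w => (xi w, eta w)) @^-1` (setT `*` B) = eta @^-1` B.
  by apply/seteqP; split => w //= [].
by [].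
Qed.

(** Here [sl / k] is [theta^2]. The terms come from the two Bernstein bounds, from the largest
    multiplier and from the sum of the squared multipliers. *)
Definition deviation_prob (R : realType) (sl : R) (k : nat) : R :=
  4 * expR (- sl) + 2 * k%:R * expR (1 / 2 - (16 * (sl / k%:R))^-1)
  + 2 * expR (- k%:R).

(** The supremum may not be attained, but half of a positive lower bound for it is reached: this is
    the [lambda / 2] of the final comparison. *)
Lemma exists_large_ratio (R : realType) (s p : nat) (f : 'cV[R]_p -> R)
    (rho c : R) : (exists v, @sparse_sphere R s p v) -> 0 < rho -> 0 < c ->
  c <= rho * sup [set f v | v in @sparse_sphere R s p] ->
  exists2 v, @sparse_sphere R s p v & c / 2 <= rho * f v.
Proof.
move=> [v0 v0S] rho0 c0 hc; apply/not_exists2P => hf.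
have : sup [set f v | v in @sparse_sphere R s p] <= c / 2 / rho.
  apply: ge_sup; first by exists (f v0); exists v0.
  move=> _ [v vS <-]; rewrite ler_pdivlMr// mulrC.
  by case: (hf v) => // /negP; rewrite -ltNge => /ltW.
by rewrite ler_pdivlMr// mulrC => /(le_trans hc); lra.
Qed.

Section one_population.
Context (R : realType) (C L1 : R) (hC : 0 < C) (k p s : nat)
  (k0 : (0 < k)%N) (hsp : (1 <= s <= p)%N).
Context d (T : measurableType d) (P : probability T R)
  (x : {mfun T >-> k.-tuple (p.-tuple R)}) (xi : {mfun T >-> k.-tuple R}).
Context d' (T' : measurableType d') (P' : probability T' R)
  (X U : {mfun T' >-> p.-tuple R}) (S M : 'M[R]_p).
Let theta := Num.sqrt (slog R s p / k%:R).
Definition deviation_cst : R := 2 * bernstein_cst R * (`|L1| + 1) ^+ 2 * C.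

Lemma deviation_cst_gt0 : 0 < deviation_cst.
Proof.
have b0 := bernstein_cst_gt0 R.
have L0 : 0 < (`|L1| + 1) ^+ 2 by rewrite exprn_gt0// ltr_wpDl.
by apply: mulr_gt0 hC; apply: mulr_gt0 L0; apply: mulr_gt0 b0.
Qed.

(** [lambda_max <= C lambda_min <= C v^T M v] makes the bounds of [one_sample_deviation], taken with
    [K = lambda_max], relative to [v^T M v]; its constants 2 and 12 become the 2 of [deviation_cst]
    and the factor 6. *)
Lemma population_deviation :
  mutually_independent P (fun i w => tnth (x w) i) ->
  mutually_independent P (fun i w => tnth (xi w) i) ->
  independent2 P x xi ->
  (forall i V, measurable V -> P [set w | V (tnth (xi w) i)] = normal_prob 0 1
    V) ->
  copies_of P x P' X -> isotropic P' U -> (psi2_sphere P' U <= L1%:E)%E ->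
  is_sqrtmx S M -> (forall w, vec (X w) = S *m vec (U w)) ->
  0 < lambda_min s M -> lambda_max s M / lambda_min s M <= C ->
  theta <= 1 / 2 ->
  exists B : set T, [/\ measurable B,
    (P B <= (deviation_prob (slog R s p) k)%:E)%E &
    forall w, ~ B w -> forall v, @sparse_sphere R s p v ->
      `|qform (sample_cov (x w)) v - qform M v|
         <= deviation_cst * theta * qform M v /\
      `|qform (boot_cov (x w) (xi w)) v|
         <= 6 * (deviation_cst * theta) * qform M v].
Proof.
move=> indx indxi x_xi nxi xX isoU psiU SM XU l0 lC theta_le.
have kR : 0 < k%:R :> R by rewrite ltr0n.
have sl0 : 0 < slog R s p.
  have [_] := slog_ge R hsp; apply: lt_le_trans.
  by case/andP: hsp; rewrite ltr0n.
have theta0 : 0 < theta by rewrite sqrtr_gt0 divr_gt0.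
have theta2 : theta ^+ 2 = slog R s p / k%:R.
  by rewrite sqr_sqrtr// ltW// divr_gt0.
have slE : slog R s p = theta ^+ 2 * k%:R by rewrite theta2 divfK// gt_eqF.
have L0 : 0 < `|L1| + 1 by rewrite ltr_wpDl.
have M_gt0 v : @sparse_sphere R s p v -> 0 < qform M v.
  by move=> /(lambda_bounds M)/andP[h _]; exact: lt_le_trans h.
have M_le v : @sparse_sphere R s p v -> qform M v <= lambda_max s M.
  by move=> /(lambda_bounds M)/andP[].
have max_le v : @sparse_sphere R s p v -> lambda_max s M <= C * qform M v.
  move=> /(lambda_bounds M)/andP[h _]; rewrite ler_pdivrMr// in lC.
  by apply: le_trans lC _; rewrite ler_wpM2l// ltW.
have [B [mB PB hB]] := @one_sample_deviation _ _ _ _ _ _ _ x xi M _ _ _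
  indx indxi x_xi nxi hsp L0 theta0 M_gt0 M_le
  (fun i v _ => sample_psi2 xX psiU SM XU i (v := v))
  (sample_second_moment xX isoU psiU SM XU) slE theta_le k0.
exists B; split=> //; first by rewrite -slE theta2 in PB.
move=> w /hB hw v vS; have [h1 h2] := hw v vS.
pose c : R := 2 * bernstein_cst R * (`|L1| + 1) ^+ 2 * theta.
have c0 : 0 <= c.
  have := deviation_cst_gt0; rewrite /deviation_cst => hd.
  by rewrite /c mulr_ge0 ?(ltW theta0)// -(pmulr_lge0 _ hC) ltW.
have hc := ler_wpM2l c0 (max_le v vS).
by split; [apply: le_trans h1 _|apply: le_trans h2 _];
  move: hc; rewrite /c /deviation_cst; lra.
Qed.

End one_population.

(** The left side equals [sqrt (1 + n / m) * sqrt sl / n], and [1 / n] is exactly the weight of the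
    first matrix in the denominator of the ratio. *)
Lemma rho_theta_le (R : realType) (n m : nat) (K sl : R) : (0 < n)%N -> (0 <
  m)%N ->
  0 <= sl -> n%:R / m%:R <= K ->
  Num.sqrt ((n + m)%:R / (n * m)%:R) * Num.sqrt (sl / n%:R) <=
  Num.sqrt (1 + K) * Num.sqrt sl * n%:R^-1.
Proof.
rewrite -(ltr0n R) -(ltr0n R m) => n0 m0 sl0 nm.
have K0 : 0 <= K by apply: le_trans nm; rewrite divr_ge0// ltW.
have nE : n%:R^-1 = Num.sqrt (n%:R^-1 ^+ 2) :> R.
  by rewrite sqrtr_sqr ger0_norm// invr_ge0 ltW.
rewrite [X in _ <= _ * X]nE.
rewrite -!sqrtrM ?divr_ge0 ?mulr_ge0 ?addr_ge0 ?ler0n// ler_sqrt; last first.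
  by rewrite mulr_ge0 ?sqr_ge0// mulr_ge0// addr_ge0.
rewrite natrD natrM.
have -> : (n%:R + m%:R) / (n%:R * m%:R) * (sl / n%:R) =
    (1 + n%:R / m%:R) * (sl * n%:R^-1 ^+ 2) :> R.
  by field; rewrite !gt_eqF.
by rewrite -mulrA ler_wpM2r ?mulr_ge0 ?sqr_ge0// lerD2l.
Qed.

(** * Power at fixed sample sizes *)

Section power.
Context (R : realType) (alpha C L1 K lambda : R) (halpha : 0 < alpha < 1)
  (hC : 0 < C) (n m p s : nat) (n0 : (0 < n)%N) (m0 : (0 < m)%N)
  (hsp : (1 <= s <= p)%N) (hnm : n%:R / m%:R <= K) (hmn : m%:R / n%:R <= K).
Context d (T : measurableType d) (P : probability T R)
  (x : {mfun T >-> n.-tuple (p.-tuple R)}) (y : {mfun T >-> m.-tuple (p.-tuple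
    R)})
  (xi : {mfun T >-> n.-tuple R}) (eta : {mfun T >-> m.-tuple R})
  (kappa : R.-pker (n.-tuple (p.-tuple R) * m.-tuple (p.-tuple R))%type ~> R)
  (M : 'M[R]_p * 'M[R]_p).
Let sl := slog R s p.
Let g := deviation_cst C L1.
Let h := Num.sqrt (1 + K).
Let beta := g * h * Num.sqrt sl.

(** Both the quantile and the statistic are compared with [12 * beta]. Two events can spoil this:
    [B], of probability at most [eps], and, by Markov's inequality with probability at most
    [eps / alpha], a conditional mass of at least [alpha] beyond that level. *)
Lemma power_bound :
  alternatives n m s C lambda M ->
  two_sample_model P x y M.1 M.2 L1 ->
  gaussian_multipliers P (fun w => (x w, y w)) xi eta ->
  is_cond_distribution P (fun w => (x w, y w))
    (fun w => B_max s (x w) (y w) (xi w) (eta w)) kappa ->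
  Num.sqrt (sl / n%:R) <= 1 / 2 -> Num.sqrt (sl / m%:R) <= 1 / 2 ->
  g * Num.sqrt (sl / n%:R) <= 1 / 2 -> g * Num.sqrt (sl / m%:R) <= 1 / 2 ->
  38 * g * h <= lambda ->
  ((1 - (1 + alpha^-1) * (deviation_prob sl n + deviation_prob sl m))%:E <=
    P [set w | (test s (x w) (y w)
                (quantile (kappa (x w, y w)) (1 - alpha)) = 1)%R])%E.
Proof.
have scale (a b c l : R) : 38 * a * b * c <= l -> 38 * (a * b * c) <= l.
  by rewrite !mulrA.
(* [12 b <= 2 / 3 (l / 2 - b)] amounts to [38 b <= l]. *)
have split38 (b l : R) : 0 < b -> 38 * b <= l ->
    b <= l / 2 /\ 12 * b <= 2 / 3 * (l / 2 - b).
  by move=> *; split; lra.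
move=> [[psd1 psd2] [l1 lC1] [l2 lC2] hsup] [indxy model] [indxieta nrm ind2]
  cond
  tn tm gn gm hl.
have [dT' [T' [P' [X [Y [U1 [U2 [S1 [S2 [[xX _ _] [yY _ _] [_ iso1 _ iso2]
  [sq1 sq2 XU YU] psi]]]]]]]]]] := model.
have /andP[alpha0 alpha1] := halpha.
have /andP[psi1 psi2] : (psi2_sphere P' U1 <= L1%:E)%E &&
    (psi2_sphere P' U2 <= L1%:E)%E by rewrite -ge_max.
have sl0 : 0 < sl.
  have [_] := slog_ge R hsp; apply: lt_le_trans.
  by case/andP: hsp; rewrite ltr0n.
have [B1 [mB1 PB1 hB1]] := population_deviation hC n0 hsp
  (mutually_independent_inl indxy) (mutually_independent_inl indxieta)
  (independent2_fst ind2) (fun i V mV => nrm (inl i) V mV)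
  xX iso1 psi1 sq1 XU l1 lC1 tn.
have [B2 [mB2 PB2 hB2]] := population_deviation hC m0 hsp
  (mutually_independent_inr indxy) (mutually_independent_inr indxieta)
  (independent2_snd ind2) (fun i V mV => nrm (inr i) V mV)
  yY iso2 psi2 sq2 YU l2 lC2 tm.
have [mB PB] := measurable_setU_le mB1 mB2 PB1 PB2.
set B := B1 `|` B2 in mB PB.
have g0 : 0 < g by exact: deviation_cst_gt0.
have K0 : 0 <= K by apply: le_trans hnm; rewrite divr_ge0.
have h0 : 0 < h by rewrite sqrtr_gt0 ltr_wpDr.
have r0 : 0 < Num.sqrt sl by rewrite sqrtr_gt0.
have beta0 : 0 < beta by apply: mulr_gt0 r0; apply: mulr_gt0 g0 h0.
have nR : 0 < n%:R :> R by rewrite ltr0n.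
have mR : 0 < m%:R :> R by rewrite ltr0n.
have pos1 v : @sparse_sphere R s p v -> 0 < qform M.1 v.
  by move=> /(lambda_bounds M.1)/andP[hv _]; exact: lt_le_trans hv.
have pos2 v : @sparse_sphere R s p v -> 0 < qform M.2 v.
  by move=> /(lambda_bounds M.2)/andP[hv _]; exact: lt_le_trans hv.
have rho0 : 0 < Num.sqrt ((n + m)%:R / (n * m)%:R) :> R.
  by rewrite sqrtr_gt0 divr_gt0// ?natrM ?mulr_gt0// natrD addr_gt0.
have beta_ge v : @sparse_sphere R s p v ->
    Num.sqrt ((n + m)%:R / (n * m)%:R) *
    (g * Num.sqrt (sl / n%:R) * qform M.1 v + g * Num.sqrt (sl / m%:R) * qform
      M.2 v)
    <= beta * qform (n%:R^-1 *: M.1 + m%:R^-1 *: M.2) v.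
  move=> vS; rewrite qform_mxD !qform_mxZ.
  have h1 := rho_theta_le n0 m0 (ltW sl0) hnm.
  have h2 := rho_theta_le m0 n0 (ltW sl0) hmn.
  rewrite addnC mulnC in h2.
  have h1' := ler_wpM2r (mulr_ge0 (ltW g0) (ltW (pos1 v vS))) h1.
  have h2' := ler_wpM2r (mulr_ge0 (ltW g0) (ltW (pos2 v vS))) h2.
  move: h1' h2'; rewrite /beta /h; move: (Num.sqrt _) (Num.sqrt (1 + K)).
  move: (Num.sqrt sl) (Num.sqrt (sl / n%:R)) (Num.sqrt (sl / m%:R)).
  move: (qform M.1 v) (qform M.2 v) n%:R^-1 m%:R^-1 (g) => *; lra.
have Bmax_le w : ~ B w -> B_max s (x w) (y w) (xi w) (eta w) <= 12 * beta.
  move=> /not_orP[/hB1 a1 /hB2 a2]; apply: ge_sup.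
    have [v vS] := sparse_sphere_nonempty R hsp.
    by eexists; exists v.
  move=> _ [v vS <-]; have [a11 a12] := a1 v vS; have [a21 a22] := a2 v vS.
  exact: (boot_ratio_le n0 m0 (pos1 v vS) (pos2 v vS) a11 a21 gn gm
    (beta_ge v vS) a12 a22).
have Qmax_ge w : ~ B w -> 12 * beta <= Q_max s (x w) (y w).
  move=> /not_orP[/hB1 a1 /hB2 a2].
  have lr0 : 0 < lambda * Num.sqrt sl.
    apply: mulr_gt0 r0; apply: lt_le_trans hl; apply: mulr_gt0 h0.
    by apply: mulr_gt0 g0.
  have [v vS hv] := exists_large_ratio (sparse_sphere_nonempty R hsp) rho0 lr0
    hsup.
  have [a11 _] := a1 v vS; have [a21 _] := a2 v vS.
  have hlb : 38 * beta <= lambda * Num.sqrt sl.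
    have hl' : 38 * g * h * Num.sqrt sl <= lambda * Num.sqrt sl.
      by rewrite ler_wpM2r// ltW.
    exact: scale hl'.
  have [hbg hQ] := split38 _ _ beta0 hlb.
  have hr := sample_ratio_ge n0 m0 (pos1 v vS) (pos2 v vS) a11 a21 gn gm
    (beta_ge v vS) hv hbg.
  apply: le_trans hQ _.
  apply: le_trans hr _; apply: sup_upper_bound; last by exists v.
  exact: has_sup_Q.
pose V : set R := `]12 * beta, +oo[%classic.
have mV : measurable V by exact: measurable_itv.
have mxy : measurable_fun [set: T] (fun w =>
  (x w, y w)) by exact: measurable_fun_pair.
have mkV : measurable_fun [set: T] (fun w => kappa (x w, y w) V).
  exact: (measurableT_comp (measurable_kernel kappa _ mV) mxy).
have mBV : measurable ((fun w => B_max s (x w) (y w) (xi w) (eta w)) @^-1` V).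
  rewrite -[X in measurable X]setTI.
  exact: (measurable_B_max n0 m0 hsp x y xi eta).
(* Over the full data space the conditional distribution averages to the probability of
   [B_max > 12 * beta], an event contained in [B]. *)
have intV : (\int[P]_w kappa (x w, y w) V <= P B)%E.
  have := cond [set: _] V measurableT mV; rewrite preimage_setT setTI => <-.
  apply: le_measure; rewrite ?inE// => w /=; rewrite /V/= in_itv/= andbT => hw.
  by apply: contrapT => /Bmax_le; rewrite leNgt hw.
pose A := [set w | (alpha%:E <= kappa (x w, y w) V)%E].
have mA : measurable A.
  by rewrite -[X in measurable X]setTI; exact: emeasurable_fun_c_infty.
set eps := deviation_prob sl n + deviation_prob sl m in PB *.
have PA : (P A <= (alpha^-1 * eps)%:E)%E.
  have hA : (alpha%:E * P A <= eps%:E)%E.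
    apply: le_trans PB; apply: le_trans intV.
    have -> : P A = (\int[P]_w (\1_A w)%:E)%E by rewrite integral_indic// setIT.
    rewrite -ge0_integralZl_EFin//; [|exact/measurable_EFinP|exact: ltW].
    apply: ge0_le_integral => //.
    - by move=> w _; rewrite -EFinM lee_fin mulr_ge0// ltW.
    - by apply: emeasurable_funM => //; exact/measurable_EFinP.
    - move=> w _; rewrite indicE; case: (boolP (w \in A)) => [/[!inE]|_].
        by rewrite mule1.
      by rewrite mule0.
  by rewrite EFinM -lee_pdivlMl// in hA *.
have [mBA PBA] := measurable_setU_le mB mA PB PA.
set G := (X in (_ <= P X)%E).
have mq := measurable_quantile kappa (1 - alpha) mxy.
have mG : measurable G.
  have -> : G = [set w | (quantile (kappa (x w, y w)) (1 - alpha) <=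
      Q_max s (x w) (y w))%R].
    apply/seteqP; split => w /=; rewrite /G/= /test; last by move=> ->.
    by case: (_ <= _)%R => //= /esym/eqP; rewrite oner_eq0.
  have := measurable_fun_ler mq (measurable_Q_max n0 m0 hsp x y).
  move=> /(_ measurableT [set true] _); rewrite setTI; apply.
  by [].
apply: (@le_trans _ _ (P (~` (B `|` A)))).
  rewrite probability_setC// EFinB; apply: leeB => //; apply: le_trans PBA _.
  by rewrite lee_fin mulrDl mul1r.
apply: le_measure; rewrite ?inE//; first exact: measurableC.
move=> w /not_orP[nB nA]; rewrite /G/= /test.
suff -> : (quantile (kappa (x w, y w)) (1 - alpha) <= Q_max s (x w) (y w))%R by
  [].
apply: le_trans (Qmax_ge w nB); apply: quantile_le;
  first by rewrite mulr_ge0// ltW.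
have mVc : measurable [set u : R | (u <= 12 * beta)%R].
  have -> : [set u : R | (u <= 12 * beta)%R] = `]-oo, 12 * beta]%classic.
    by apply/seteqP; split => u /=; rewrite in_itv.
  exact: measurable_itv.
(* Outside [A] the upper tail has mass below [alpha], so the conditional distribution function is at
   least [1 - alpha] at [12 * beta]. *)
have k1 : (kappa (x w, y w) [set u : R | (u <= 12 * beta)%R] +
    kappa (x w, y w) V = 1)%E.
  rewrite -measureU//.
  - rewrite (_ : _ `|` _ = [set: R]); first exact: prob_kernel.
    apply/seteqP; split => u //= _; rewrite /V/= in_itv/= andbT.
    by case: (leP u (12 * beta)); [left|right].
  - apply/seteqP; split => u //= -[]; rewrite /V/= in_itv/= andbT.
    by move=> h1 h2; move: (lt_le_trans h2 h1); rewrite ltxx.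
have kfin : kappa (x w, y w) V \is a fin_num.
  rewrite ge0_fin_numE//; apply: le_lt_trans (ltry 1); rewrite -k1.
  exact: leeDr.
have kV : (kappa (x w, y w) V <= alpha%:E)%E.
  by apply: ltW; rewrite ltNge; apply/negP.
rewrite EFinB -k1 leeBlDr//; apply: leeD => //.
Qed.

End power.

(** The difference is [(s - 1) (ln p - ln s) + (s - 1 - ln s)], with both terms nonnegative. The
    bound makes [slog] diverge with the dimension, whatever the sparsity. *)
Lemma slog_ge_ln (R : realType) (s p : nat) : (1 <= s <= p)%N ->
  1 + ln p%:R <= slog R s p.
Proof.
move=> hsp; have [-> _] := slog_ge R hsp.
have /andP[s1 sp] := hsp.
have s0 : 1 <= s%:R :> R by rewrite ler1n.
have p0 : 0 < p%:R :> R by rewrite ltr0n (leq_trans s1).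
have s_gt0 : 0 < s%:R :> R by lra.
rewrite ln_div ?posrE//.
have lsp : ln s%:R <= ln p%:R :> R by rewrite ler_ln ?posrE// ler_nat.
have lns : ln s%:R <= s%:R - 1 :> R.
  have -> : s%:R = 1 + (s%:R - 1) :> R by ring.
  by rewrite addrAC subrr add0r le_ln1Dx//; lra.
nra.
Qed.

(** [32 = 2 * 16] makes [1 / (16 theta^2)] at least [2 ln n], so that the union over [k <= K1 n]
    multipliers leaves order [1 / n]. [harmonic j = 1 / (j + 1)] replaces [1 / j] at the cost of a
    factor 2. *)
Lemma deviation_prob_le (R : realType) (K1 : R) (n k s p : nat) :
  (1 <= n)%N -> (1 <= k)%N -> (1 <= s <= p)%N -> 1 <= K1 ->
  n%:R <= K1 * k%:R -> k%:R <= K1 * n%:R ->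
  32 * K1 * (slog R s p * ln n%:R) <= n%:R ->
  deviation_prob (slog R s p) k <=
    8 * harmonic p + (4 * expR (1 / 2) + 4) * K1 * harmonic n.
Proof.
move=> n1 k1 hsp K11 nk kn hr.
have nR : 1 <= n%:R :> R by rewrite ler1n.
have kR : 1 <= k%:R :> R by rewrite ler1n.
have pR : 1 <= p%:R :> R by rewrite ler1n; case/andP: hsp => /leq_trans; exact.
have half (j : nat) : 1 <= j%:R :> R -> j%:R^-1 <= 2 * harmonic j :> R.
  move=> j1; rewrite /harmonic -natr1 -[leLHS]mul1r ler_pdivrMr; last by lra.
  by rewrite mulrAC ler_pdivlMr; lra.
have sl0 : 0 < slog R s p.
  have := slog_ge_ln R hsp; have : 0 <= ln p%:R :> R by exact: ln_ge0.
  by lra.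
have e1 : expR (- slog R s p) <= 2 * harmonic p :> R.
  apply: le_trans (half p pR).
  rewrite expRN lef_pV2 ?posrE ?expR_gt0//; last by lra.
  rewrite -[leLHS]lnK ?posrE; last by lra.
  by rewrite ler_expR; have := slog_ge_ln R hsp; lra.
have e2 : k%:R * expR (1 / 2 - (16 * (slog R s p / k%:R))^-1) <=
    K1 * expR (1 / 2) * (2 * harmonic n).
  have lk : 2 * ln n%:R <= (16 * (slog R s p / k%:R))^-1.
    have -> : (16 * (slog R s p / k%:R))^-1 = k%:R / (16 * slog R s p).
      by field; rewrite !gt_eqF//; lra.
    rewrite ler_pdivlMr; last by lra.
    rewrite -(@ler_pM2l _ K1); last by lra.
    by apply: le_trans nk; lra.
  rewrite expRD.
  have en : expR (- (16 * (slog R s p / k%:R))^-1) <= n%:R^-1 * n%:R^-1 :> R.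
    apply: (@le_trans _ _ (expR (- (2 * ln n%:R))));
      first by rewrite ler_expR lerN2.
    have -> : 2 * ln n%:R = ln n%:R + ln n%:R :> R by ring.
    by rewrite expRN expRD lnK ?posrE ?invfM//; lra.
  have ni : 0 < n%:R^-1 :> R by rewrite invr_gt0; lra.
  apply: (@le_trans _ _ (K1 * n%:R * (expR (1 / 2) * (n%:R^-1 * n%:R^-1)))).
    by apply: ler_pM => //; rewrite ler_wpM2l ?expR_ge0.
  have -> : K1 * n%:R * (expR (1 / 2) * (n%:R^-1 * n%:R^-1)) =
      K1 * expR (1 / 2) * n%:R^-1.
    by field; rewrite gt_eqF//; lra.
  rewrite ler_wpM2l ?half// mulr_ge0 ?expR_ge0//; lra.
have e3 : expR (- k%:R) <= K1 * (2 * harmonic n) :> R.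
  apply: (@le_trans _ _ (K1 * n%:R^-1)); last by rewrite ler_wpM2l ?half//; lra.
  rewrite expRN -[K1]invrK -invfM lef_pV2 ?posrE ?expR_gt0//; last first.
    by rewrite mulr_gt0 ?invr_gt0//; lra.
  rewrite mulrC ler_pdivrMr; last by lra.
  apply: le_trans nk _; rewrite mulrC ler_wpM2r//; first by lra.
  by have := expR_ge1Dx (k%:R : R); lra.
rewrite /deviation_prob -[2 * k%:R * _]mulrA.
by move: e1 e2 e3; move: (harmonic n) (harmonic p) => a b; lra.
Qed.

Lemma sqrt_ratio_le (R : realType) (sl K1 g : R) (n k : nat) :
  (1 <= n)%N -> (1 <= k)%N -> 0 < g -> 0 <= sl -> n%:R <= K1 * k%:R ->
  K1 * (32 + 4 * g ^+ 2) * sl <= n%:R ->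
  Num.sqrt (sl / k%:R) <= 1 / 2 /\ g * Num.sqrt (sl / k%:R) <= 1 / 2.
Proof.
rewrite -(ler1n R) -(ler1n R k) => n1 k1 g0 sl0 nk h.
have K10 : 0 < K1.
  rewrite ltNge; apply/negP => K10.
  have : K1 * k%:R <= 0 by apply: mulr_le0_ge0 => //; lra.
  lra.
have hk : (32 + 4 * g ^+ 2) * sl <= k%:R.
  by rewrite -(@ler_pM2l _ K1)//; apply: le_trans nk; rewrite mulrA.
have g2 : 0 <= g ^+ 2 * sl by rewrite mulr_ge0// sqr_ge0.
have half2 : Num.sqrt ((1 / 2) ^+ 2) = 1 / 2 :> R by rewrite sqrtr_sqr
  ger0_norm.
split.
  rewrite -half2 ler_sqrt ?sqr_ge0// ler_pdivrMr; last by lra.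
  by rewrite expr2; lra.
have -> : g = Num.sqrt (g ^+ 2) by rewrite sqrtr_sqr gtr0_norm.
rewrite -sqrtrM ?sqr_ge0// -half2 ler_sqrt ?sqr_ge0// mulrA ler_pdivrMr;
  last by lra.
by rewrite [(1 / 2) ^+ 2]expr2; lra.
Qed.

Theorem theorem4p2 (R : realType) (alpha C L1 : R)
  (halpha : 0 < alpha < 1) (hC : 0 < C)
  (m d s : nat -> nat)
  (hs : forall n, (1 <= s n <= d n)%N)
  (hnm : exists K : R, \forall n \near \oo,
     [/\ (0 < m n)%N, n%:R / (m n)%:R <= K & (m n)%:R / n%:R <= K])
  (* The dimension diverges: for bounded d the conclusion fails at every fixed
     lambda, the alternatives at distance lambda / sqrt n being contiguous
     to the null hypothesis. *)
  (hd : d n @[n --> \oo] --> \oo)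
  (hrate : (fun n => slog R (s n) (d n) * ln n%:R : R^o)
             =o_\oo (fun n => n%:R : R^o))
  (disp : nat -> measure_display)
  (Omega : forall n, measurableType (disp n))
  (x : forall n, {mfun Omega n >-> n.-tuple ((d n).-tuple R)})
  (y : forall n, {mfun Omega n >-> (m n).-tuple ((d n).-tuple R)})
  (xi : forall n, {mfun Omega n >-> n.-tuple R})
  (eta : forall n, {mfun Omega n >-> (m n).-tuple R})
  (Pr : forall n, 'M[R]_(d n) -> 'M[R]_(d n) -> probability (Omega n) R)
  (kappa : forall n, 'M[R]_(d n) -> 'M[R]_(d n) ->
     R.-pker (n.-tuple ((d n).-tuple R) * (m n).-tuple ((d n).-tuple R))%type
       ~> R)
  (hmodel : forall n (Sigma1 Sigma2 : 'M[R]_(d n)),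
     psdmx Sigma1 -> psdmx Sigma2 ->
     two_sample_model (Pr n Sigma1 Sigma2) (x n) (y n) Sigma1 Sigma2 L1)
  (hmult : forall n (Sigma1 Sigma2 : 'M[R]_(d n)),
     psdmx Sigma1 -> psdmx Sigma2 ->
     gaussian_multipliers (Pr n Sigma1 Sigma2) (fun w => (x n w, y n w))
       (xi n) (eta n))
  (hkappa : forall n (Sigma1 Sigma2 : 'M[R]_(d n)),
     psdmx Sigma1 -> psdmx Sigma2 ->
     is_cond_distribution (Pr n Sigma1 Sigma2) (fun w => (x n w, y n w))
       (fun w => B_max (s n) (x n w) (y n w) (xi n w) (eta n w))
       (kappa n Sigma1 Sigma2)) :
  \forall lambda \near +oo,
    inf_prob [set Pr n M.1 M.2
                [set w | test (s n) (x n w) (y n w)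
                   (quantile (kappa n M.1 M.2 (x n w, y n w)) (1 - alpha)) = 1]
             | M in @alternatives R n (m n) (d n) (s n) C lambda]
      @[n --> \oo] --> 1%E.
Proof.
have [K hK] := hnm.
pose g := deviation_cst C L1.
have g0 : 0 < g by exact: deviation_cst_gt0.
pose K1 := `|K| + 1.
have K11 : 1 <= K1 by rewrite /K1 lerDr.
have K10 : 0 < K1 by exact: lt_le_trans ltr01 K11.
(* The threshold depends on [C], [L1] and [K] alone; [alpha] enters through the rate in [low]. *)
pose lambda0 := 38 * g * Num.sqrt (1 + `|K|).
have c0 : 0 < 32 + 4 * g ^+ 2.
  have g2 : 0 < g ^+ 2 by exact: exprn_gt0.
  by move: g2; move: (g ^+ 2) => u; lra.
(* One [e] serves three purposes: [4 g^2] gives [g theta <= 1 / 2], and 32 covers both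
   [theta <= 1 / 2] and the tail of the multipliers. [K1] transfers the bounds to the second sample
   size. *)
pose e := (K1 * (32 + 4 * g ^+ 2))^-1.
have e0 : 0 < e by rewrite invr_gt0; exact: mulr_gt0 K10 c0.
have /eqoP/(_ e e0) hr := hrate.
pose c : R := (4 * expR (1 / 2) + 4) * K1.
pose low n : R := 1 - (1 + alpha^-1) * (2 * (8 * harmonic (d n) + c * harmonic
  n)).
near=> lambda.
have hlam : lambda0 <= lambda by near: lambda; apply: nbhs_pinfty_ge;
  exact: num_real.
have a0 : 0 < 1 + alpha^-1 by rewrite addr_gt0// invr_gt0; case/andP: halpha.
have harm0 j : 0 <= harmonic j :> R by rewrite /harmonic invr_ge0.
have cc0 : 0 <= c.
  by apply: mulr_ge0 (ltW K10); have := expR_gt0 (1 / 2 : R); lra.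
apply: (@squeeze_cvge _ _ _ _ (fun n => (low n)%:E) _ (fun=> 1%E)).
- near=> n.
  have [m0 nm mn] : [/\ (0 < m n)%N, n%:R / (m n)%:R <= K & (m n)%:R / n%:R <=
    K].
    by near: n.
  have n1 : (1 <= n)%N by near: n; exact: nbhs_infty_ge.
  (* Once [ln n >= 1], the rate condition bounds [slog] itself as well as [slog * ln n]. *)
  have ne : expR 1 <= n%:R :> R by near: n; exact: nbhs_infty_ger.
  have hrn : `|slog R (s n) (d n) * ln n%:R| <= e * `|n%:R : R| by near: n.
  apply/andP; split; last by apply: ereal_inf_lbound; right.
  have nR : 0 < n%:R :> R by rewrite ltr0n.
  have mR : 0 < (m n)%:R :> R by rewrite ltr0n.
  have KK : K <= `|K| by exact: ler_norm.
  have n_mn : n%:R <= K1 * (m n)%:R.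
    by rewrite -ler_pdivrMr// /K1; lra.
  have mn_n : (m n)%:R <= K1 * n%:R.
    by rewrite -ler_pdivrMr// /K1; lra.
  have n_n : n%:R <= K1 * n%:R by rewrite ler_peMl.
  have sl0 : 0 <= slog R (s n) (d n).
    by have [_] := slog_ge R (hs n); apply: le_trans.
  have ln1 : 1 <= ln n%:R :> R by rewrite -ler_expR lnK ?posrE.
  have hsl : K1 * (32 + 4 * g ^+ 2) * (slog R (s n) (d n) * ln n%:R) <= n%:R.
    rewrite -ler_pdivlMl; last exact: mulr_gt0 K10 c0.
    by apply: le_trans (ler_norm _) _; rewrite (ger0_norm (ltW nR)) in hrn.
  have K1g : 0 <= K1 * (32 + 4 * g ^+ 2) by exact: mulr_ge0 (ltW K10) (ltW c0).
  have hsl1 : K1 * (32 + 4 * g ^+ 2) * slog R (s n) (d n) <= n%:R.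
    apply: (le_trans _ hsl); apply: ler_wpM2l => //; exact: ler_peMr.
  have hsl2 : 32 * K1 * (slog R (s n) (d n) * ln n%:R) <= n%:R.
    apply: le_trans hsl; rewrite ler_wpM2r//; first by rewrite mulr_ge0//; lra.
    rewrite mulrC; apply: ler_wpM2l; first exact: ltW.
    by rewrite lerDl; apply: mulr_ge0 => //; exact: sqr_ge0.
  have [tn gn] := sqrt_ratio_le n1 n1 g0 sl0 n_n hsl1.
  have [tm gm] := sqrt_ratio_le n1 m0 g0 sl0 n_mn hsl1.
  have dn := deviation_prob_le n1 n1 (hs n) K11 n_n n_n hsl2.
  have dm := deviation_prob_le n1 m0 (hs n) K11 n_mn mn_n hsl2.
  (* The set whose infimum is taken also contains 1, which is at least [low n]. *)
  apply: le_ereal_inf_tmp => _ [[M MA <-]|->]; last first.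
    rewrite lee_fin /low gerBl; apply: mulr_ge0 (ltW a0) _.
    by apply: mulr_ge0 => //; apply: addr_ge0; exact: mulr_ge0.
  have [[psd1 psd2] _ _ _] := MA.
  have pb := (power_bound halpha hC n1 m0 (hs n) (le_trans nm KK)
    (le_trans mn KK) MA (hmodel n _ _ psd1 psd2)
    (hmult n _ _ psd1 psd2) (hkappa n _ _ psd1 psd2)
    tn tm gn gm hlam).
  apply: le_trans pb.
  rewrite lee_fin /low lerD2l lerN2 ler_pM2l//.
  by move: dn dm; rewrite -/c; lra.
- apply: cvg_EFin; first exact: nearW.
  rewrite /low -[X in _ --> X]subr0 -[X in _ - X](mulr0 (1 + alpha^-1)).
  apply: cvgB; first exact: cvg_cst.
  apply: cvgMr; rewrite -[X in _ --> X](mulr0 2); apply: cvgMr.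
  rewrite -[X in _ --> X](addr0 0) -[X in _ --> X + _](mulr0 8)
    -[X in _ --> _ + X](mulr0 c).
  apply: cvgD; apply: cvgMr; last exact: cvg_harmonic.
  (* The divergence of [d] enters here: [harmonic (d n)] is what bounds the [exp (- slog)] terms. *)
  exact: (@cvg_comp _ _ _ d harmonic _ _ _ hd cvg_harmonic).
- exact: cvg_cst.
Unshelve. all: by end_near.
Qed.
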